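(* The algebra $M_{4A}$ is $12$-dimensional (i.e. free of rank $12$ over its coefficient ring). It has basis $$\{a_1,a_{-1},a_2,a_{-2},a_3,a_{-3}\}\cup\{v_{(1,2)},v_{(1,3)},v_{(2,3)}\}\cup\{a_1\cdot v_{(2,3)},\ a_2\cdot v_{(1,3)},\ a_3\cdot v_{(1,2)}\}$$ where $v_{(i,j)}=a_i+a_j+\frac13a_{-i}+\frac13a_{-j}-\frac{2^6}{3}a_i\cdot a_j$ for $i,j\in\{1,2,3\}$, $i\neq j$. Its coefficient ring $R_{4A}$ is equal to the polynomial ring $\mathbb{R}[t]$, where $t:=\langle a_1,v_{(2,3)}\rangle$.
   Context: Algebras are commutative but not necessarily associative, over a commutative ring $R$ with $1$ containing $\mathbb{R}$ as a subfield. For an idempotent $a\in V$ and $\lambda\in R$ put $V_\lambda^{(a)}=\{v\in V: a\cdot v=\lambda v\}$, and for $\Lambda\subseteq R$ put $V_\Lambda^{(a)}=\bigoplus_{\lambda\in\Lambda}V_\lambda^{(a)}$ ($V_\emptyset^{(a)}=0$). The Monster fusion rule $(\mathcal{M},* )$ has $\mathcal{M}=\{1,0,\frac14,\frac1{32}\}$ and symmetric $*$ with $1*1=\{1\}$, $1*0=\emptyset$, $0*0=\{0\}$, $1*\frac14=0*\frac14=\{\frac14\}$, $\frac14*\frac14=\{1,0\}$, $\lambda*\frac1{32}=\{\frac1{32}\}$ for $\lambda\in\{1,0,\frac14\}$, $\frac1{32}*\frac1{32}=\{1,0,\frac14\}$. An idempotent $a$ is an $(\mathcal{M},* )$-axis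 if $V=\bigoplus_{\lambda\in\mathcal{M}}V_\lambda^{(a)}$ and $V_\lambda^{(a)}\cdot V_\mu^{(a)}\subseteq V_{\lambda*\mu}^{(a)}$ for all $\lambda,\mu\in\mathcal{M}$; it is primitive if $V_1^{(a)}=Ra$. A primitive Frobenius $(\mathcal{M},* )$-axial algebra is an algebra generated by a set $A$ of primitive $(\mathcal{M},* )$-axes with a Frobenius form, i.e. a nonzero $R$-bilinear form $\langle\,,\rangle$ with $\langle u,v\cdot w\rangle=\langle u\cdot v,w\rangle$, normalised by $\langle a,a\rangle=1$ for axes $a\in A$. The Miyamoto involution $\tau(a)$ acts as $1$ on $V_1^{(a)}\oplus V_0^{(a)}\oplus V_{1/4}^{(a)}$ and as $-1$ on $V_{1/32}^{(a)}$. Property $\mathcal{P}$: $A=\{a_1,a_{-1},a_2,a_{-2},a_3,a_{-3}\}$ and on $A$, $\tau(a_1)=\tau(a_{-1})=(a_2,a_{-2})(a_3,a_{-3})$, $\tau(a_2)=\tau(a_{-2})=(a_1,a_{-1})(a_3,a_{-3})$, $\tau(a_3)=\tau(a_{-3})=(a_1,a_{-1})(a_2,a_{-2})$. Shape $4A$: for all distinct $i,j\in\{1,2,3\}$ the subalgebra $\langle\langle a_i,a_j\rangle\rangle$ generated by $a_i,a_j$ is of type $4A$, i.e. it is spanned by $a_{\pm i},a_{\pm j}$ and an idempotent $v=v_{(i,j)}=v_{(j,i)}$ such that, for all signs $\epsilon,\delta$: $a_{\epsilon i}\cdot a_{\delta j}=\frac1{64}(3a_{\epsilon i}+3a_{\delta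 j}+a_{-\epsilon i}+a_{-\delta j}-3v)$, $a_{\epsilon i}\cdot v=\frac1{16}(5a_{\epsilon i}-a_{-\epsilon i}-2a_j-2a_{-j}+3v)$, $a_{\delta j}\cdot v=\frac1{16}(5a_{\delta j}-a_{-\delta j}-2a_i-2a_{-i}+3v)$, $a_i\cdot a_{-i}=a_j\cdot a_{-j}=0$, $\langle a_{\epsilon i},a_{\delta j}\rangle=\frac1{32}$, $\langle a_i,a_{-i}\rangle=\langle a_j,a_{-j}\rangle=0$, $\langle a_{\epsilon i},v\rangle=\langle a_{\delta j},v\rangle=\frac38$, $\langle v,v\rangle=2$. Universal algebra: let $\hat X$ be the free commutative non-associative magma on $\hat a_{\pm1},\hat a_{\pm2},\hat a_{\pm3}$; let $\sim$ be the equivalence relation on $\hat X\times\hat X$ generated by $(\hat x\cdot\hat y,\hat z)\sim(\hat x,\hat y\cdot\hat z)$; let $\hat R=\mathbb{R}[\lambda_{[\hat x,\hat y]}]$ be the polynomial ring with one indeterminate for each $\sim$-class; let $\hat M=\hat R\hat X$ be the algebra of formal $\hat R$-linear combinations of elements of $\hat X$, with $\hat R$-bilinear form $\langle\hat x,\hat y\rangle=\lambda_{[\hat x,\hat y]}$. For ideals $I$ of $\hat M$ and $J\ne\hat R$ of $\hat R$ with $J\hat M\subseteq I$ and $\langle I,\hat M\rangle\subseteq J$, the quotient $\hat M/I$ is an algebra with form over its coefficient ring $\hat R/J$, with marked generators $a_{\pm i}$ the images of $\hat a_{\pm i}$. Let $\mathcal{C}_{4A}$ be the class of such quotients which are primitive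 Frobenius $(\mathcal{M},* )$-axial algebras (with axes the marked generators) satisfying property $\mathcal{P}$ and having shape $4A$. $M_{4A}$ denotes the universal member of $\mathcal{C}_{4A}$ (given by the smallest pair $(I,J)$; all members of $\mathcal{C}_{4A}$ are quotients of it), and $R_{4A}=\hat R/J$ its coefficient ring. *)

(* Defs.v *)
From HB Require Import structures.
From mathcomp Require Import all_boot all_order all_algebra.
From mathcomp Require Import finmap boolp reals.
From mathcomp.multinomials Require Import monalg.

Set Implicit Arguments.
Unset Strict Implicit.
Unset Printing Implicit Defensive.

Import GRing.Theory.
Local Open Scope ring_scope.
Local Open Scope quotient_scope.

(* The index of a_i is (i, true) and that of a_{-i} is (i, false); the indices
   1, 2, 3 are the elements 0, 1, 2 of 'I_3. *)
Definition gidx : Type := ('I_3 * bool)%type.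
Definition i1 : 'I_3 := @Ordinal 3 0 isT.
Definition i2 : 'I_3 := @Ordinal 3 1 isT.
Definition i3 : 'I_3 := @Ordinal 3 2 isT.

(* An algebra over an overring of R (via [iota]), together with a form and six
   marked elements. No axiom on the product and the form is imposed here: see
   [is_comm_algebra] and [is_frobenius_form]. *)
Record markedAlg (R : realType) := MarkedAlg {
  coef : comNzRingType;
  iota : {rmorphism R -> coef};
  carrier :> lmodType coef;
  amul : carrier -> carrier -> carrier;
  aform : carrier -> carrier -> coef;
  gen : gidx -> carrier }.

Variant monster := ev1 | ev0 | ev4 | ev32.

Definition monsters : seq monster := [:: ev1; ev0; ev4; ev32].

Definition mval (R : realType) (l : monster) : R :=
  match l with ev1 => 1 | ev0 => 0 | ev4 => 4^-1 | ev32 => 32^-1 end.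

Definition mstar (l m : monster) : seq monster :=
  match l, m with
  | ev1, ev1 => [:: ev1]
  | ev1, ev0 | ev0, ev1 => [::]
  | ev0, ev0 => [:: ev0]
  | ev1, ev4 | ev4, ev1 | ev0, ev4 | ev4, ev0 => [:: ev4]
  | ev4, ev4 => [:: ev1; ev0]
  | ev32, ev32 => [:: ev1; ev0; ev4]
  | ev32, _ | _, ev32 => [:: ev32]
  end.

Section AxialAlgebra.
Variables (R : realType) (M : markedAlg R).
Implicit Types (a u v w : M) (L : seq monster).

Local Notation "u ** v" := (@amul R M u v) (at level 40, left associativity).
Local Notation "<[ u , v ]>" := (@aform R M u v).
Local Notation "k %:S" := (iota M k) (at level 2, format "k %:S").

Definition is_comm_algebra : Prop :=
  (forall u v, u ** v = v ** u) /\
  (forall (c : coef M) u v w, (c *: u + v) ** w = c *: (u ** w) + v ** w).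

Definition is_frobenius_form : Prop :=
  [/\ forall (c : coef M) u v w, <[c *: u + v, w]> = c * <[u, w]> + <[v, w]>,
      forall (c : coef M) u v w, <[w, c *: u + v]> = c * <[w, u]> + <[w, v]>,
      forall u v w, <[u, v ** w]> = <[u ** v, w]> &
      exists u v, <[u, v]> <> 0].

Definition is_subalgebra (U : M -> Prop) : Prop :=
  [/\ U 0, forall (c : coef M) u v, U u -> U v -> U (c *: u + v) &
      forall u v, U u -> U v -> U (u ** v)].

Definition subalg_gen (G : M -> Prop) (v : M) : Prop :=
  forall U : M -> Prop, is_subalgebra U -> (forall u, G u -> U u) -> U v.

Definition eigenspace a (l : monster) v : Prop := a ** v = (mval R l)%:S *: v.

Definition eigensum a L v : Prop :=
  exists2 f : monster -> M,
    forall l, eigenspace a l (f l) & v = \sum_(l <- L) f l.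

Definition is_axis a : Prop :=
  [/\ a ** a = a,
      forall v, eigensum a monsters v,
      forall f : monster -> M, (forall l, eigenspace a l (f l)) ->
        \sum_(l <- monsters) f l = 0 -> forall l, f l = 0 &
      forall l m u v, eigenspace a l u -> eigenspace a m v ->
        eigensum a (mstar l m) (u ** v)].

Definition is_primitive a : Prop :=
  forall v, eigenspace a ev1 v <-> exists c : coef M, v = c *: a.

Definition is_primitive_frobenius_axial : Prop :=
  [/\ is_comm_algebra,
      is_frobenius_form,
      forall g, [/\ is_axis (gen M g), is_primitive (gen M g)
                  & <[gen M g, gen M g]> = 1] &
      forall v, subalg_gen (fun u => exists g, u = gen M g) v].

Definition is_miyamoto a (T : M -> M) : Prop :=
  (forall (c : coef M) u v, T (c *: u + v) = c *: T u + T v) /\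
  (forall l v, eigenspace a l v -> T v = if l is ev32 then - v else v).

Definition property_P : Prop :=
  forall i e, exists T : M -> M,
    [/\ is_miyamoto (gen M (i, e)) T,
        forall d, T (gen M (i, d)) = gen M (i, d) &
        forall j d, j != i -> T (gen M (j, d)) = gen M (j, ~~ d)].

Definition type4A (i j : 'I_3) (v : M) : Prop :=
  let a (e : bool) := gen M (i, e) in
  let b (d : bool) := gen M (j, d) in
  [/\ v ** v = v,
      forall x, subalg_gen (fun u => u = a true \/ u = b true) x <->
        exists c1 c2 c3 c4 c5 : coef M,
          x = c1 *: a true + c2 *: a false + c3 *: b true + c4 *: b false
              + c5 *: v,
      [/\ forall e d, a e ** b d = (64^-1)%:S *:
            (3 *: a e + 3 *: b d + a (~~ e) + b (~~ d) - 3 *: v),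
          forall e, a e ** v = (16^-1)%:S *:
            (5 *: a e - a (~~ e) - 2 *: b true - 2 *: b false + 3 *: v),
          forall d, b d ** v = (16^-1)%:S *:
            (5 *: b d - b (~~ d) - 2 *: a true - 2 *: a false + 3 *: v),
          a true ** a false = 0 &
          b true ** b false = 0],
      [/\ forall e d, <[a e, b d]> = (32^-1)%:S,
          <[a true, a false]> = 0 & <[b true, b false]> = 0] &
      [/\ forall e, <[a e, v]> = (3 / 8)%:S,
          forall d, <[b d, v]> = (3 / 8)%:S & <[v, v]> = 2]].

Definition shape4A : Prop :=
  exists v : 'I_3 -> 'I_3 -> M,
    (forall i j, v i j = v j i) /\
    (forall i j, i != j -> type4A i j (v i j)).

Definition vax (i j : 'I_3) : M :=
  gen M (i, true) + gen M (j, true)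
  + (3^-1)%:S *: gen M (i, false) + (3^-1)%:S *: gen M (j, false)
  - (2 ^+ 6 / 3)%:S *: (gen M (i, true) ** gen M (j, true)).

Definition basis12 : 12.-tuple M :=
  [tuple gen M (i1, true); gen M (i1, false);
         gen M (i2, true); gen M (i2, false);
         gen M (i3, true); gen M (i3, false);
         vax i1 i2; vax i1 i3; vax i2 i3;
         gen M (i1, true) ** vax i2 i3;
         gen M (i2, true) ** vax i1 i3;
         gen M (i3, true) ** vax i1 i2].

Definition is_basis n (b : n.-tuple M) : Prop :=
  forall v, exists! c : {ffun 'I_n -> coef M}, v = \sum_i c i *: tnth b i.

Definition tpar : coef M := <[gen M (i1, true), vax i2 i3]>.

Definition poly_to_coef (x : coef M) (p : {poly R}) : coef M :=
  (map_poly (iota M) p).[x].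

End AxialAlgebra.

Inductive tree : Type := Leaf of gidx | Node of tree & tree.

HB.instance Definition _ := gen_eqMixin tree.
HB.instance Definition _ := gen_choiceMixin tree.

(* The congruence on binary trees generated by commutativity. *)
Inductive tree_rel : tree -> tree -> Prop :=
| tree_refl x : tree_rel x x
| tree_sym x y : tree_rel x y -> tree_rel y x
| tree_trans y x z : tree_rel x y -> tree_rel y z -> tree_rel x z
| tree_comm x y : tree_rel (Node x y) (Node y x)
| tree_cong x x' y y' :
    tree_rel x x' -> tree_rel y y' -> tree_rel (Node x y) (Node x' y').

Definition tree_eqv (x y : tree) : bool := `[< tree_rel x y >].

Lemma tree_eqv_refl : reflexive tree_eqv.
Proof. by move=> x; apply/asboolP; apply: tree_refl. Qed.
Lemma tree_eqv_sym : symmetric tree_eqv.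
Proof. by move=> x y; apply/asboolP/asboolP; apply: tree_sym. Qed.
Lemma tree_eqv_trans : transitive tree_eqv.
Proof.
by move=> y x z /asboolP xy /asboolP yz; apply/asboolP; apply: tree_trans yz.
Qed.

Canonical tree_equiv := EquivRel tree_eqv tree_eqv_refl tree_eqv_sym tree_eqv_trans.

Definition magma : Type := {eq_quot tree_equiv}.
HB.instance Definition _ := Choice.on magma.

Definition tgen (g : gidx) : magma := \pi_({eq_quot tree_equiv}) (Leaf g).
Definition tmul (x y : magma) : magma :=
  \pi_({eq_quot tree_equiv})
    (Node (repr (x : {eq_quot tree_equiv})) (repr (y : {eq_quot tree_equiv}))).

Inductive assoc_rel : magma * magma -> magma * magma -> Prop :=
| assoc_refl p : assoc_rel p p
| assoc_sym p q : assoc_rel p q -> assoc_rel q p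
| assoc_trans q p r : assoc_rel p q -> assoc_rel q r -> assoc_rel p r
| assoc_gen x y z : assoc_rel (tmul x y, z) (x, tmul y z).

Definition assoc_eqv (p q : magma * magma) : bool := `[< assoc_rel p q >].

Lemma assoc_eqv_refl : reflexive assoc_eqv.
Proof. by move=> x; apply/asboolP; apply: assoc_refl. Qed.
Lemma assoc_eqv_sym : symmetric assoc_eqv.
Proof. by move=> x y; apply/asboolP/asboolP; apply: assoc_sym. Qed.
Lemma assoc_eqv_trans : transitive assoc_eqv.
Proof.
by move=> y x z /asboolP xy /asboolP yz; apply/asboolP; apply: assoc_trans yz.
Qed.

Canonical assoc_equiv :=
  EquivRel assoc_eqv assoc_eqv_refl assoc_eqv_sym assoc_eqv_trans.

Definition lclass : Type := {eq_quot assoc_equiv}.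
HB.instance Definition _ := Choice.on lclass.

Definition lcls (x y : magma) : lclass := \pi_({eq_quot assoc_equiv}) (x, y).

Section Universal.
Variable R : realType.

(* The polynomial ring over R in the family of indeterminates [lclass]: the
   monoid algebra of the free commutative monoid on [lclass]. *)
Definition Rhat : comNzRingType := {malg R[{cmonom lclass}]}.

Definition lam (x y : magma) : Rhat := << ucm (lcls x y) >>.

Definition Mhat : lmodType Rhat := {malg Rhat[magma]}.

Definition hgen (g : gidx) : Mhat := << tgen g >>.

Definition hmul (f g : Mhat) : Mhat :=
  \sum_(x <- msupp f) \sum_(y <- msupp g) << f@_x * g@_y *g tmul x y >>.

Definition hform (f g : Mhat) : Rhat :=
  \sum_(x <- msupp f) \sum_(y <- msupp g) f@_x * g@_y * lam x y.

(* [idealr] are the ideals not containing 1. *)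
Record idealPair := IdealPair {
  pI : zmodClosed Mhat;
  pJ : idealr Rhat;
  pI_scale : forall r m, m \in pI -> r *: m \in pI;
  pI_ideal : forall m u, u \in pI -> hmul m u \in pI;
  pJ_scale : forall r m, r \in pJ -> r *: m \in pI;
  pI_form : forall u m, u \in pI -> hform u m \in pJ }.

Section Quotient.
Variable P : idealPair.

Definition Rquo : comNzRingType := {ideal_quot (pJ P)}.
Definition Mquo : Type := (Quotient.quot (pI P)).
HB.instance Definition _ := GRing.Zmodule.on Mquo.

Definition piR (r : Rhat) : Rquo := \pi_({ideal_quot (pJ P)}) r.
Definition piM (m : Mhat) : Mquo := \pi_(Quotient.quot (pI P)) m.
Definition repR (r : Rquo) : Rhat := repr (r : {ideal_quot (pJ P)}).
Definition repM (m : Mquo) : Mhat := repr (m : (Quotient.quot (pI P))).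

Definition qscale (c : Rquo) (m : Mquo) : Mquo := piM (repR c *: repM m).
Definition qmul (u v : Mquo) : Mquo := piM (hmul (repM u) (repM v)).
Definition qform (u v : Mquo) : Rquo := piR (hform (repM u) (repM v)).

Lemma piR_eq r s : (r - s \in pJ P) = (piR r == piR s).
Proof. exact: Quotient.idealrBE. Qed.

Lemma piM_eq m n : (m - n \in pI P) = (piM m == piM n).
Proof. exact: Quotient.idealrBE. Qed.

Lemma repRK : cancel repR piR. Proof. by move=> c; rewrite /piR reprK. Qed.
Lemma repMK : cancel repM piM. Proof. by move=> u; rewrite /piM reprK. Qed.

Lemma piR_zmod : zmod_morphism piR.
Proof. exact: (raddfB \pi_({ideal_quot (pJ P)})). Qed.
Lemma piR_monoid : monoid_morphism piR.
Proof.
split; first exact: (rmorph1 \pi_({ideal_quot (pJ P)})).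
exact: (rmorphM \pi_({ideal_quot (pJ P)})).
Qed.
HB.instance Definition _ := GRing.isZmodMorphism.Build Rhat Rquo piR piR_zmod.
HB.instance Definition _ := GRing.isMonoidMorphism.Build Rhat Rquo piR piR_monoid.

Lemma piM_zmod : zmod_morphism piM.
Proof. exact: (raddfB \pi_(Quotient.quot (pI P))). Qed.
HB.instance Definition _ := GRing.isZmodMorphism.Build Mhat Mquo piM piM_zmod.

Lemma qscale_pi r m : qscale (piR r) (piM m) = piM (r *: m).
Proof.
set c := repR (piR r); set n := repM (piM m); apply/eqP; rewrite -piM_eq.
have -> : c *: n - r *: m = (c - r) *: n + r *: (n - m).
  by rewrite (scalerBl c r n) (scalerBr r n m) (addrA _ (r *: n)) (addrNK (r *: n)).
apply: rpredD; first by apply: pJ_scale; rewrite piR_eq repRK.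
by apply: pI_scale; rewrite piM_eq repMK.
Qed.

Lemma qscaleA c d u : qscale c (qscale d u) = qscale (c * d) u.
Proof.
rewrite -[c]repRK -[d]repRK -[u]repMK -rmorphM !qscale_pi.
by rewrite scalerA.
Qed.
Lemma qscale1 : left_id 1 qscale.
Proof. by move=> u; rewrite -[u]repMK -(rmorph1 piR) qscale_pi scale1r. Qed.
Lemma qscaleDr : right_distributive qscale +%R.
Proof.
move=> c u v; rewrite -[c]repRK -[u]repMK -[v]repMK -raddfD !qscale_pi.
by rewrite -raddfD scalerDr.
Qed.
Lemma qscaleDl u : {morph qscale^~ u : c d / c + d}.
Proof.
move=> c d /=; rewrite -[c]repRK -[d]repRK -[u]repMK -raddfD !qscale_pi.
by rewrite -raddfD scalerDl.
Qed.
HB.instance Definition _ :=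
  GRing.Zmodule_isLmodule.Build Rquo Mquo qscaleA qscale1 qscaleDr qscaleDl.

Definition Rhat_const : {rmorphism R -> Rhat} := @malgC {cmonom lclass} R.

(* For u, u' congruent modulo I, [pI_form] makes the value of the form independent
   of the choice of u or u' as left argument. For the right argument this follows
   as soon as the marked generators are idempotent in the quotient, since
   <m n, p> = <p, m n> holds in Mhat. *)
Definition quotAlg : markedAlg R :=
  @MarkedAlg R Rquo (piR \o Rhat_const) Mquo qmul qform (fun g => piM (hgen g)).

End Quotient.

Definition in_class4A (P : idealPair) : Prop :=
  [/\ is_primitive_frobenius_axial (quotAlg P), property_P (quotAlg P)
    & shape4A (quotAlg P)].

Definition is_universal4A (P : idealPair) : Prop :=
  in_class4A P /\
  forall Q : idealPair, in_class4A Q ->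
    {subset pI P <= pI Q} /\ {subset pJ P <= pJ Q}.

End Universal.

(* Main.v *)
(* In a member of the class, let a be an axis and let u_n, w_n be eigenvectors of a
   for 0 or 1/4. The fusion rules give a (sum_n u_n w_n) in terms of the products
   u_n w_n and of the values of the form; when sum_n u_n w_n lies in the span of
   the 12 elements of the basis, this is a linear relation between the products of
   these elements. With well chosen eigenvectors, such relations determine all
   the products one after the other, and associativity of the form then gives all
   its values, as elements of Z[1/192][t]: every member is spanned by the 12
   elements, with the same structure constants. Conversely, these constants define
   an algebra with form on R[t]^12, and membership in the class amounts to
   finitely many identities between them, which hold by computation. The
   universal pair consists of the kernels of the evaluations of the hat algebra
   and of the hat ring in this algebra and in R[t]. *)

From Stdlib Require Import ZArith.
From HB Require Import structures.
From mathcomp Require Import all_boot all_algebra.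
From mathcomp Require Import finmap boolp reals.
From mathcomp Require Import ssrZ.
From mathcomp.multinomials Require Import monalg.
Require Import Defs.

Set Implicit Arguments.
Unset Strict Implicit.
Unset Printing Implicit Defensive.

Import GRing.Theory Num.Theory.
(* MathComp has rebound the key [Z] to its own integers. *)
Delimit Scope Z_scope with ZZ.

(** * Integer polynomials, vectors and product tables *)

(** In a member of the class the coefficient ring is arbitrary and may have zero divisors, and the
    12 elements are not known to be independent. No relation can be read off coordinate by
    coordinate: it is solved only for a product whose coefficient is a nonzero integer, a unit
    because the ring contains the reals. This constraint, and the need for a single unknown at a
    time, dictate the chain of relations. The computation is therefore done by a calculator on
    formal vectors over Z[t], sound under evaluation in every module. The converse direction does
    not rest on freeness either. Eigenspace decompositions and fusion rules are checked on Lagrange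
    projections of the 12 elements, so that the same lemmas apply to the model over R[t] and to the
    universal quotient itself. Freeness, and the absence of relations on t, come only from the
    model, where the unit vectors are independent and t is the variable. *)

Definition zpoly := seq Z.
Definition zvec := seq zpoly.

(** Trailing zeros are dropped here and in [vcons], so that [nilp] can test for zero and [size] can
    bound the coordinates in use. *)
Definition pcons (c : Z) (p : zpoly) : zpoly :=
  if nilp p && Z.eqb c 0 then [::] else c :: p.
Fixpoint padd (p q : zpoly) : zpoly :=
  match p, q with
  | [::], _ => q
  | _, [::] => p
  | c :: p', d :: q' => pcons (c + d) (padd p' q')
  end.
Fixpoint pscale (c : Z) (p : zpoly) : zpoly :=
  if p is d :: p' then pcons (c * d) (pscale c p') else [::].
Fixpoint pmul (p q : zpoly) : zpoly :=
  if p is c :: p' then padd (pscale c q) (pcons 0 (pmul p' q)) else [::].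

Definition vcons (p : zpoly) (u : zvec) : zvec :=
  if nilp u && nilp p then [::] else p :: u.
Fixpoint vadd (u w : zvec) : zvec :=
  match u, w with
  | [::], _ => w
  | _, [::] => u
  | p :: u', q :: w' => vcons (padd p q) (vadd u' w')
  end.
Fixpoint vscale (p : zpoly) (u : zvec) : zvec :=
  if p is [::] then [::] else
  if u is q :: u' then vcons (pmul p q) (vscale p u') else [::].
Definition vsub (u w : zvec) : zvec := vadd u (vscale [:: (-1)%ZZ] w).
Definition vsum (l : seq zvec) : zvec := foldr vadd [::] l.
Definition unit_vec (k : nat) : zvec := ncons k [::] [:: [:: 1%ZZ]].
Definition zvcomb (l : seq (Z * nat)) : zvec :=
  foldr (fun x => vadd (vscale [:: x.1] (unit_vec x.2))) [::] l.
Definition tvcomb (l : seq (Z * nat)) : zvec := vscale [:: 0; 1]%ZZ (zvcomb l).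

Fixpoint lcomb (u : zvec) (f : nat -> zvec) : zvec :=
  if u is p :: u' then vadd (vscale p (f 0)) (lcomb u' (fun k => f k.+1))
  else [::].

(* A bilinear map on the span of 12 elements is given by its 144 values, in
   row-major order. *)
Definition table := seq zvec.
Definition entry (T : table) (i j : nat) : zvec := nth [::] T (12 * i + j).
Definition mulv (T : table) (u w : zvec) : zvec :=
  lcomb u (fun i => lcomb w (entry T i)).
Definition mk_table (f : nat -> nat -> zvec) : table :=
  [seq f (k %/ 12) (k %% 12) | k <- seq.iota 0 144].
Definition set_sym (T : table) (i j : nat) (r : zvec) : table :=
  set_nth [::] (set_nth [::] T (12 * i + j) r) (12 * j + i) r.
Definition pair_index (i j : nat) : nat := 12 * minn i j + maxn i j.
Definition lin (u : zvec) : bool := size u <= 12.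

(* Indices of a_i (e = true) or a_{-i} (e = false), of v_(i,j), of v_(j,k) with
   {i, j, k} = {0, 1, 2}, and of a_i v_(j,k), all of them in [basis12]. *)
Definition ax (i : nat) (e : bool) : nat := i.*2 + ~~ e.
Definition vx (i j : nat) : nat := 5 + i + j.
Definition vopp (i : nat) : nat := 8 - i.
Definition xx (i : nat) : nat := 9 + i.
Definition flip (k : nat) : nat := if odd k then k.-1 else k.+1.

(* All computations use 192 times the elements of [basis12]: their structure
   constants lie in Z[t]. The products and the values of the form that the
   hypotheses do not give are kept as symbols, namely additional coordinates. *)
Definition mul0 (i j : nat) : zvec :=
  let i' := minn i j in let j' := maxn i j in
  let a := i'./2 in let b := j'./2 in
  let unknown := unit_vec (12 + pair_index i' j') in
  if j' < 6 then
    if i' == j' then zvcomb [:: (192%ZZ, i')]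
    else if a == b then [::]
    else zvcomb [:: (9, i'); (9, j'); (3, flip i'); (3, flip j');
                    (-9, vx a b)]%ZZ
  else if j' < 9 then
    if i' == j' then zvcomb [:: (192%ZZ, i')]
    else if i' < 6 then
      if j' == vopp a then
        if odd i' then unknown else zvcomb [:: (192%ZZ, xx a)]
      else let c := (j' - 5 - a)%N in
        zvcomb [:: (60, i'); (-12, flip i'); (-24, ax c true);
                   (-24, ax c false); (36, j')]%ZZ
    else unknown
  else unknown.

(** This and the next formula are the 4A products multiplied by 192^2 and written on elements scaled
    by 192: 9 = 192 * 3 / 64 and 60 = 192 * 5 / 16. *)
Definition axis_axis (i : nat) (e : bool) (j : nat) (d : bool) : zvec :=
  zvcomb [:: (9, ax i e); (9, ax j d); (3, ax i (~~ e)); (3, ax j (~~ d));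
            (-9, vx i j)]%ZZ.
Definition axis_idem4A (i : nat) (e : bool) (j : nat) : zvec :=
  zvcomb [:: (60, ax i e); (-12, ax i (~~ e)); (-24, ax j true);
            (-24, ax j false); (36, vx i j)]%ZZ.

Definition sc (c : Z) : zvec := zvcomb [:: (c, 0)].
(** Values are scaled by 192^2 = 36864, so that 1152, 13824 and 73728 stand for 1/32, 3/8 and 2. Of
    the values on an axis and the opposite idempotent, only <a_1, v_(2,3)> is given at the start, as
    t. *)
Definition form0 (i j : nat) : zvec :=
  let i' := minn i j in let j' := maxn i j in
  let unknown := unit_vec (1 + pair_index i' j') in
  if j' < 6 then
    if i' == j' then sc 36864
    else if i'./2 == j'./2 then [::] else sc 1152
  else if j' < 9 then
    if i' == j' then sc 73728
    else if i' < 6 then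
      if j' == vopp i'./2 then
        if i' == 0 then [:: [:: 0; 36864]%ZZ] else unknown
      else sc 13824
    else unknown
  else unknown.

(** * Deriving products from the fusion rules *)

Definition state := (table * table)%type.
Definition state0 : state := (mk_table mul0, mk_table form0).

(* Solves the relation [r = 0] for the unknown of index [k], provided that the
   division is exact and that the value has at most [n] coordinates. *)
Definition pdivz (c : Z) (p : zpoly) : zpoly := [seq Z.div x c | x <- p].
Definition vsolve (n k : nat) (r : zvec) : option zvec :=
  if nth [::] r k is [:: c] then
    let rest := vadd r (vscale [:: (- c)%ZZ] (unit_vec k)) in
    let s := [seq pdivz (- c) p | p <- rest] in
    if [&& ~~ Z.eqb c 0, size s <= n & nilp (vadd rest (vscale [:: c] s))]
    then Some s else None
  else None.

(* [p; q; r; i; j] stands for <p, qr> = <pq, r>, to be solved for <i, j>. *)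
Definition form_step (st : state) (x : seq nat) : option state :=
  let: (M, F) := st in
  if x is [:: p; q; r; i; j] then
    let rel := vsub (mulv F (unit_vec p) (entry M q r))
                    (mulv F (entry M p q) (unit_vec r)) in
    if [&& p < 12, q < 12, r < 12, i < 12, j < 12,
           size (entry M q r) <= 12 & size (entry M p q) <= 12] then
      if vsolve 1 (1 + pair_index i j) rel is Some s then
        Some (M, set_sym F i j s) else None
    else None
  else None.

(* [(false, u)] is an eigenvector for 0 and [(true, u)] one for 1/4. A term
   [(c, u, w)] stands for the product c u w. In a group [(g, l)] the sum of the
   terms of [l] must be known in the basis: multiplying it by the axis [g] gives
   a relation, because the fusion rules tell how [g] acts on each term. *)
Definition eigv := (bool * zvec)%type.
Definition term := (Z * eigv * eigv)%type.
Definition group := (nat * seq term)%type.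

Definition is_eigv (M : table) (g : nat) (u : eigv) : bool :=
  lin u.2 &&
  nilp (vsub (mulv M (unit_vec g) u.2)
             (if u.1 then vscale [:: 48%ZZ] u.2 else [::])).
(** For two eigenvectors for 1/4 the value of the form becomes a coefficient of the relation, so it
    must be a polynomial in t without unknown symbols. *)
Definition term_ok (st : state) (g : nat) (x : term) : bool :=
  let: (c, u, w) := x in
  [&& is_eigv st.1 g u, is_eigv st.1 g w &
      u.1 ==> w.1 ==> (size (mulv st.2 u.2 w.2) <= 1)].
Definition term_val (st : state) (x : term) : zvec :=
  let: (c, u, w) := x in vscale [:: c] (mulv st.1 u.2 w.2).
Definition term_rhs (st : state) (g : nat) (x : term) : zvec :=
  let: (c, u, w) := x in
  match u.1, w.1 with
  | false, false => [::]
  | true, true =>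
      vscale (pscale c (nth [::] (mulv st.2 u.2 w.2) 0)) (unit_vec g)
  | _, _ => vscale [:: (192 * c)%ZZ] (mulv st.1 u.2 w.2)
  end.

Definition group_ok (st : state) (x : group) : bool :=
  [&& x.1 < 6, all (term_ok st x.1) x.2 & lin (vsum (map (term_val st) x.2))].
Definition group_rel (st : state) (x : group) : zvec :=
  vsub (vscale [:: 4%ZZ]
          (mulv st.1 (unit_vec x.1) (vsum (map (term_val st) x.2))))
       (vsum (map (term_rhs st x.1) x.2)).

Definition mul_step (st : state) (gs : seq group) (i j : nat) : option state :=
  if [&& i < 12, j < 12 & all (group_ok st) gs] then
    if vsolve 12 (12 + pair_index i j) (vsum (map (group_rel st) gs)) is Some s
    then Some (set_sym st.1 i j s, st.2) else None
  else None.

Definition step := (seq nat + seq group * nat * nat)%type.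
Definition exec (st : state) (s : step) : option state :=
  match s with
  | inl x => form_step st x
  | inr (gs, i, j) => mul_step st gs i j
  end.
Definition run (st : state) (l : seq step) : option state :=
  foldl (fun o s => obind (fun st => exec st s) o) (Some st) l.

(* Eigenvectors of a_i (or a_{-i} in [alpha false i j]), up to a factor. With
   y_i = a_i v_(j,k) - t a_i, the last two are v_(j,k) - t a_i - 4 y_i and
   y_j + y_k - y_i / 2 + t (a_j + a_{-j} + a_k + a_{-k}) / 2 - 3 t a_i / 8. *)
Definition alpha (e : bool) (i j : nat) : eigv :=
  (false, zvcomb [:: (2, vx i j); (-1, ax i e); (4, ax j true);
                     (4, ax j false)]%ZZ).
Definition beta (i j : nat) : eigv :=
  (true, zvcomb [:: (3, vx i j); (-1, ax i true); (-1, ax i false);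
                    (-2, ax j true); (-2, ax j false)]%ZZ).
Definition zeta4 (i : nat) : eigv :=
  (true, vadd (zvcomb [:: (1%ZZ, xx i)]) (tvcomb [:: ((-1)%ZZ, ax i true)])).
Definition zeta0 (i : nat) : eigv :=
  (false, vadd (zvcomb [:: (1, vopp i); (-4, xx i)]%ZZ)
               (tvcomb [:: (3%ZZ, ax i true)])).
Definition sigma0 (i j k : nat) : eigv :=
  (false, vadd (zvcomb [:: (8, xx j); (8, xx k); (-4, xx i)]%ZZ)
     (tvcomb [:: (-4, ax j true); (4, ax j false); (-4, ax k true);
                 (4, ax k false); (1, ax i true)]%ZZ)).

(* The differences [2 beta - 3 alpha] only involve axes, so that the product of
   two of them is known. *)
Definition quad (c : Z) (e : bool) (i j k : nat) : group :=
  (ax i e, [:: (9 * c, alpha e i j, alpha e i k)%ZZ;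
               (-6 * c, alpha e i j, beta i k)%ZZ;
               (-6 * c, beta i j, alpha e i k)%ZZ;
               (4 * c, beta i j, beta i k)%ZZ]).

Definition triples := [:: (0, 1, 2); (1, 0, 2); (2, 0, 1)].
Definition for_triples (T : Type) (f : nat -> nat -> nat -> seq T) : seq T :=
  flatten [seq let: (i, j, k) := x in f i j k | x <- triples].

(* The value <a_i v_(j,k), m>. *)
Definition form_prod (i m : nat) : step :=
  inl (if (m < 9) && (m != vopp i) then [:: vopp i; ax i true; m; m; xx i]
       else [:: ax i true; vopp i; m; m; xx i]).

(** Below, x_i stands for a_i v_(j,k). The first relations show that the form takes the value t on
    every axis and its opposite idempotent. *)
Definition steps : seq step :=
  [:: inl [:: ax 0 true; ax 1 true; ax 2 true; ax 2 true; vx 0 1];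
      inl [:: ax 0 true; ax 1 true; ax 2 false; ax 2 false; vx 0 1];
      inl [:: ax 0 true; ax 2 true; ax 1 true; ax 1 true; vx 0 2];
      inl [:: ax 0 true; ax 2 true; ax 1 false; ax 1 false; vx 0 2];
      inl [:: ax 0 false; ax 1 true; ax 2 true; ax 0 false; vx 1 2]]
  ++ for_triples (fun i j k =>
       [:: inl [:: ax j true; ax i true; vx i k; vx i j; vx i k]])
  ++ for_triples (fun i j k =>
       (* The relations for a_i and a_-i agree in the terms v_(i,j) v_(i,k) and in the products of
          v_(i,j) with a_k, a_-k and of v_(i,k) with a_j, a_-j. These cancel in the difference,
          which leaves a_-i v_(j,k) as the only unknown. *)
       [:: inr ([:: quad 1 true i j k; quad (-1) false i j k],
                ax i false, vopp i)])
  ++ for_triples (fun i j k =>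
       [:: inr ([:: quad 1 true i j k], vx i j, vx i k)])
  ++ for_triples (fun i j k => flatten
       (* As 3 alpha - 2 beta only involves axes, its product with the other alpha lies in the span.
          It has a term in x_k, whence the product of the axis with x_k; the next step is the mirror
          image for x_j. *)
       [seq [:: inr ([:: (ax i e, [:: (3%ZZ, alpha e i j, alpha e i k);
                                      ((-2)%ZZ, alpha e i j, beta i k)])],
                     ax i e, xx k);
                inr ([:: (ax i e, [:: (3%ZZ, alpha e i j, alpha e i k);
                                      ((-2)%ZZ, beta i j, alpha e i k)])],
                     ax i e, xx j);
                (* By the [quad] relation this sum of eigenvectors for 1/4 is a combination of axes,
                   idempotents and x_i, without x_j and x_k. Being such an eigenvector, it
                   determines the product of the axis with x_i. *)
                inr ([:: (ax i e, [:: (1%ZZ, alpha e i j, beta i k);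
                                      (1%ZZ, beta i j, alpha e i k)])],
                     ax i e, xx i)]
       | e <- [:: true; false]])
  ++ for_triples (fun i j k =>
       (* The sum is [zeta0] times a combination of axes, hence known. The axis kills the alpha
          term, and in beta times [zeta0] only v_(i,m) x_i is unknown. *)
       [seq inr ([:: (ax i true, [:: (3%ZZ, alpha true i m, zeta0 i);
                                     ((-2)%ZZ, beta i m, zeta0 i)])],
                 vx i m, xx i) | m <- [:: j; k]])
  ++ for_triples (fun i j k =>
       (* The same with [sigma0], in which all three x occur; the products of v_(j,k) with x_j and
          x_k are known by now. *)
       [:: inr ([:: (ax j true, [:: (3%ZZ, alpha true j k, sigma0 j i k);
                                    ((-2)%ZZ, beta j k, sigma0 j i k)])],
                vx j k, xx i)])
  ++ for_triples (fun i j k =>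
       (* [zeta0] + 4 [zeta4] equals v_(j,k) - t a_i, so the sum is known, while [zeta4] times
          [zeta0] contains the square of x_i. *)
       [:: inr ([:: (ax i true, [:: (1%ZZ, zeta0 i, zeta0 i);
                                    (4%ZZ, zeta4 i, zeta0 i)])],
                xx i, xx i)])
  ++ for_triples (fun i j k =>
       (* Up to known terms, the relation at a_i determines x_i x_j + x_i x_k. With the signs -, +,
          + for the three axes, 2 x_j x_k remains. *)
       [:: inr ([seq let: (i, j, k, c) := y in
                  (ax i true, [:: (c, zeta0 i, sigma0 i j k);
                                  ((4 * c)%ZZ, zeta4 i, sigma0 i j k)])
                | y <- [:: (i, j, k, (-1)%ZZ); (j, i, k, 1%ZZ);
                           (k, i, j, 1%ZZ)]],
                xx j, xx k)])
  (* The values on two products reduce to values on an axis and a product, which therefore come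
     first. *)
  ++ flatten [seq [seq form_prod i m | m <- seq.iota 0 6] | i <- seq.iota 0 3]
  ++ flatten [seq [seq form_prod i m | m <- seq.iota 6 3] | i <- seq.iota 0 3]
  ++ flatten [seq [seq form_prod i m | m <- seq.iota (9 + i) (3 - i)]
             | i <- seq.iota 0 3].

(** Evaluated once, so that later computations start from literal tables. The default is harmless:
    [final_ok] checks that the run succeeds with this result. *)
Definition final : state :=
  Eval vm_compute in odflt ([::], [::]) (run state0 steps).
Definition mul_table : table := final.1.
Definition form_table : table := final.2.

Local Open Scope ring_scope.
Local Open Scope quotient_scope.

(** * Evaluating integer vectors in an algebra *)

Section Evaluation.
Variables (S : comNzRingType) (t : S).

(** Locked, so that simplification does not expand large integer constants. *)
Definition zval : Z -> S := locked (fun c => (int_of_Z c)%:~R).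

Lemma zvalE c : zval c = (int_of_Z c)%:~R.
Proof. by rewrite /zval -lock. Qed.
Lemma zval_pos p : zval (Zpos p) = (Pos.to_nat p)%:R.
Proof. by rewrite zvalE. Qed.

Lemma zval0 : zval Z0 = 0. Proof. by rewrite zvalE. Qed.
Lemma zval1 : zval (Zpos 1) = 1. Proof. by rewrite zvalE. Qed.
Lemma zvalD c d : zval (Z.add c d) = zval c + zval d.
Proof. by rewrite !zvalE -intrD -rmorphD. Qed.
Lemma zvalM c d : zval (Z.mul c d) = zval c * zval d.
Proof. by rewrite !zvalE -intrM -rmorphM. Qed.
Lemma zvalN c : zval (Z.opp c) = - zval c.
Proof. by rewrite !zvalE -intrN -rmorphN. Qed.

Fixpoint peval (p : zpoly) : S := if p is c :: p' then zval c + t * peval p' else 0.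

Lemma peval_cons c p : peval (pcons c p) = zval c + t * peval p.
Proof.
rewrite /pcons; case: ifP => // /andP[/nilP -> /Z.eqb_spec ->].
by rewrite /= zval0 mulr0 addr0.
Qed.

Lemma pevalD p q : peval (padd p q) = peval p + peval q.
Proof.
elim: p q => [|c p IH] [|d q] /=; rewrite ?add0r ?addr0 //.
by rewrite peval_cons IH zvalD mulrDr addrACA.
Qed.

Lemma pevalZ c p : peval (pscale c p) = zval c * peval p.
Proof.
elim: p => [|d p IH] /=; first by rewrite mulr0.
by rewrite peval_cons IH zvalM mulrDr mulrCA.
Qed.

Lemma pevalM p q : peval (pmul p q) = peval p * peval q.
Proof.
elim: p => [|c p IH] /=; first by rewrite mul0r.
by rewrite pevalD pevalZ peval_cons IH zval0 add0r mulrDl mulrA.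
Qed.

Section Vectors.
Variable V : lmodType S.
Implicit Type f : nat -> V.

Fixpoint veval f (u : zvec) : V :=
  if u is p :: u' then peval p *: f 0%N + veval (fun k => f k.+1) u' else 0.

Lemma veval_cons f p u :
  veval f (vcons p u) = peval p *: f 0%N + veval (fun k => f k.+1) u.
Proof.
rewrite /vcons; case: ifP => // /andP[/nilP -> /nilP ->].
by rewrite /= scale0r addr0.
Qed.

Lemma vevalD f u w : veval f (vadd u w) = veval f u + veval f w.
Proof.
elim: u f w => [|p u IH] f [|q w] /=; rewrite ?add0r ?addr0 //.
by rewrite veval_cons IH pevalD scalerDl addrACA.
Qed.

Lemma vevalZ f p u : veval f (vscale p u) = peval p *: veval f u.
Proof.
case: p => [|c p]; first by case: u => [|q u]; rewrite /= scale0r.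
elim: u f => [|q u IH] f; rewrite ?scaler0 //.
rewrite -/(vcons (pmul (c :: p) q) (vscale (c :: p) u)) veval_cons IH pevalM.
by rewrite scalerDr scalerA.
Qed.

Lemma veval_unit f k : veval f (unit_vec k) = f k.
Proof.
rewrite /unit_vec; elim: k f => [|k IH] f /=.
  by rewrite mulr0 !addr0 zval1 scale1r.
by rewrite scale0r add0r IH.
Qed.

Lemma vevalB f u w : veval f (vsub u w) = veval f u - veval f w.
Proof.
by rewrite /vsub vevalD vevalZ /= mulr0 addr0 (zvalN (Zpos 1)) zval1 scaleN1r.
Qed.

Lemma veval_lcomb f u g :
  veval f (lcomb u g) = veval (fun k => veval f (g k)) u.
Proof. by elim: u g => [|p u IH] g //=; rewrite vevalD vevalZ IH. Qed.

Lemma eq_veval f g u :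
  (forall k, (k < size u)%N -> f k = g k) -> veval f u = veval g u.
Proof.
elim: u f g => [|p u IH] f g //= fg; rewrite fg // (IH _ (fun k => g k.+1)) //.
by move=> k ku; rewrite fg.
Qed.

Lemma veval_sum f us : veval f (vsum us) = \sum_(u <- us) veval f u.
Proof. by elim: us => [|u us IH] /=; rewrite ?big_nil // big_cons vevalD IH. Qed.

Lemma veval_comb f l :
  veval f (zvcomb l) = \sum_(x <- l) zval x.1 *: f x.2.
Proof.
elim: l => [|x l IH]; first by rewrite big_nil.
by rewrite big_cons [zvcomb _]/= vevalD IH vevalZ veval_unit /= mulr0 addr0.
Qed.

End Vectors.

Lemma veval_lin (U V : lmodType S) (h : U -> V) f u :
  (forall c x y, h (c *: x + y) = c *: h x + h y) ->
  h (veval f u) = veval (fun k => h (f k)) u.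
Proof.
move=> hlin; elim: u f => [|p u IH] f /=; last by rewrite hlin IH.
by have /eqP := hlin (-1) 0 0; rewrite scaler0 addr0 scaleN1r addNr => /eqP.
Qed.

Definition table_ok (U V : lmodType S) (B : U -> U -> V) (b : nat -> U)
    (f : nat -> V) (T : table) :=
  forall i j, (i < 12)%N -> (j < 12)%N -> B (b i) (b j) = veval f (entry T i j).

Lemma veval_mulv (U V : lmodType S) (B : U -> U -> V) b f T u w :
  (forall c x y z, B (c *: x + y) z = c *: B x z + B y z) ->
  (forall c x y z, B z (c *: x + y) = c *: B z x + B z y) ->
  table_ok B b f T -> (size u <= 12)%N -> (size w <= 12)%N ->
  B (veval b u) (veval b w) = veval f (mulv T u w).
Proof.
move=> Bl Br TP u12 w12; rewrite (veval_lin (h := B^~ (veval b w))) //.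
rewrite veval_lcomb; apply: eq_veval => i /leq_trans/(_ u12) i12.
rewrite (veval_lin (h := B (b i))) // veval_lcomb; apply: eq_veval => j.
by move=> /leq_trans/(_ w12) j12; apply: TP.
Qed.

Section Solve.
Variables (R : realType) (iota : {rmorphism R -> S}) (V : lmodType S).

Lemma zval_iota c : zval c = iota (int_of_Z c)%:~R.
Proof. by rewrite rmorph_int zvalE. Qed.

Lemma zval_inv c : c <> Z0 -> iota ((int_of_Z c)%:~R)^-1 * zval c = 1.
Proof.
move=> c0; rewrite zval_iota -rmorphM mulVf ?rmorph1 // intr_eq0.
by apply/eqP => c0'; apply: c0; rewrite -[c]int_of_ZK c0'.
Qed.

Lemma zval_inj c (x y : V) : c <> Z0 -> zval c *: x = zval c *: y -> x = y.
Proof.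
move=> c0 /(congr1 ( *:%R (iota ((int_of_Z c)%:~R)^-1))).
by rewrite !scalerA zval_inv // !scale1r.
Qed.

(** The division itself is not trusted: the test at the end of [vsolve] makes both sides equal after
    multiplication by c, which is a unit. *)
Lemma vsolveP n k r s (f : nat -> V) :
  veval f r = 0 -> vsolve n k r = Some s -> f k = veval f s /\ (size s <= n)%N.
Proof.
rewrite /vsolve => r0; case: nth => [|c [|]] //; case: ifP => // /and3P[c0 sn].
set rest := vadd r _; set s' := [seq _ | _ <- _] in sn *.
move=> /nilP rs [<-]; split=> //; apply: (@zval_inj c).
  by move=> c0'; rewrite c0' in c0.
have := congr1 (veval f) rs; rewrite !vevalD !vevalZ veval_unit r0 add0r /=.
by rewrite !mulr0 !addr0 zvalN scaleNr addrC => /eqP; rewrite subr_eq0 => /eqP.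
Qed.

End Solve.
End Evaluation.

Section Bilinearity.
Variables (R : realType) (N : markedAlg R).
Local Notation "u ** v" := (@amul R N u v) (at level 40, left associativity).
Local Notation "<[ u , v ]>" := (@aform R N u v).

Section Product.
Hypothesis Ncomm : is_comm_algebra N.

Lemma amulC u v : u ** v = v ** u.
Proof. by case: Ncomm. Qed.
Lemma amul_linl c x y z : (c *: x + y) ** z = c *: (x ** z) + y ** z.
Proof. by case: Ncomm. Qed.
Lemma amul_linr c x y z : z ** (c *: x + y) = c *: (z ** x) + z ** y.
Proof. by rewrite amulC amul_linl ![_ ** z]amulC. Qed.
Lemma amul0r u : u ** 0 = 0.
Proof. by have := amul_linr (-1) 0 0 u; rewrite scaler0 addr0 scaleN1r addNr. Qed.
Lemma amul0l u : 0 ** u = 0.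
Proof. by rewrite amulC amul0r. Qed.
Lemma amulZr c x z : z ** (c *: x) = c *: (z ** x).
Proof. by have := amul_linr c x 0 z; rewrite amul0r !addr0. Qed.
Lemma amulZl c x z : (c *: x) ** z = c *: (x ** z).
Proof. by rewrite amulC amulZr amulC. Qed.
Lemma amul_sumr (I : Type) (r : seq I) (f : I -> N) z :
  z ** (\sum_(i <- r) f i) = \sum_(i <- r) z ** f i.
Proof.
elim: r => [|i r IH]; first by rewrite !big_nil amul0r.
by rewrite !big_cons -[f i]scale1r amul_linr IH !scale1r.
Qed.

End Product.

Section Form.
Hypothesis Nform : is_frobenius_form N.

Lemma aform_linl c x y z : <[c *: x + y, z]> = c * <[x, z]> + <[y, z]>.
Proof. by case: Nform. Qed.
Lemma aform_linr c x y z : <[z, c *: x + y]> = c * <[z, x]> + <[z, y]>.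
Proof. by case: Nform. Qed.
Lemma aform0l u : <[0, u]> = 0.
Proof. by have := aform_linl (-1) 0 0 u; rewrite scaler0 addr0 mulN1r addNr. Qed.
Lemma aform0r u : <[u, 0]> = 0.
Proof. by have := aform_linr (-1) 0 0 u; rewrite scaler0 addr0 mulN1r addNr. Qed.
Lemma aformZl c x z : <[c *: x, z]> = c * <[x, z]>.
Proof. by have := aform_linl c x 0 z; rewrite aform0l !addr0. Qed.
Lemma aformZr c x z : <[z, c *: x]> = c * <[z, x]>.
Proof. by have := aform_linr c x 0 z; rewrite aform0r !addr0. Qed.

End Form.
End Bilinearity.

Lemma pair_index_div i j : (i < 12)%N -> (j < 12)%N ->
  (pair_index i j %/ 12 = minn i j)%N /\ (pair_index i j %% 12 = maxn i j)%N.
Proof.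
move=> i12 j12; have m12 : (maxn i j < 12)%N by rewrite gtn_max i12.
by rewrite /pair_index mulnC divnMDl // divn_small // addn0 modnMDl modn_small.
Qed.

Lemma entry_set T i j k l r : (j < 12)%N -> (l < 12)%N ->
  entry (set_nth [::] T (12 * i + j) r) k l =
  if (k == i) && (l == j) then r else entry T k l.
Proof.
move=> j12 l12; rewrite /entry nth_set_nth /=; congr (if _ then _ else _).
apply/eqP/andP => [e|[/eqP -> /eqP ->] //].
split; apply/eqP.
  have := congr1 (divn^~ 12) e.
  by rewrite /= !(mulnC 12) !divnMDl // !divn_small // !addn0.
by have := congr1 (modn^~ 12) e; rewrite /= !(mulnC 12) !modnMDl !modn_small.
Qed.

(** * Soundness of the derivation *)

Section Derivation.
Variables (R : realType) (N : markedAlg R) (b : nat -> N) (t : coef N).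

Local Notation "u ** v" := (@amul R N u v) (at level 40, left associativity).
Local Notation "<[ u , v ]>" := (@aform R N u v).
Local Notation zval := (@zval (coef N)).
Local Notation peval := (peval t).

(* Indices from 12 on stand for the products of two basis elements. *)
Definition product_env (k : nat) : N :=
  if (k < 12)%N then b k else b ((k - 12) %/ 12)%N ** b ((k - 12) %% 12)%N.

(* Index 0 is the constant 1 and the other ones are the values of the form. *)
Definition form_env (k : nat) : (coef N)^o :=
  if k is k'.+1 then <[b (k' %/ 12)%N, b (k' %% 12)%N]> else 1.

Definition state_ok (st : state) : Prop :=
  table_ok t (@amul R N) b product_env st.1 /\
  table_ok t (@aform R N : N -> N -> (coef N)^o) b form_env st.2.

Hypothesis Ncomm : is_comm_algebra N.
Hypothesis Nform : is_frobenius_form N.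
Hypothesis formC : forall u v, <[u, v]> = <[v, u]>.

Lemma product_env_small k : (k < 12)%N -> product_env k = b k.
Proof. by rewrite /product_env => ->. Qed.

Lemma product_env_pair i j : (i < 12)%N -> (j < 12)%N ->
  product_env (12 + pair_index i j) = b i ** b j.
Proof.
move=> i12 j12; have [ed em] := pair_index_div i12 j12.
rewrite /product_env ltnNge leq_addr /= addKn ed em.
by case: leqP => // _; rewrite (amulC Ncomm).
Qed.

Lemma form_env_pair i j : (i < 12)%N -> (j < 12)%N ->
  form_env (1 + pair_index i j) = <[b i, b j]>.
Proof.
move=> i12 j12; have [ed em] := pair_index_div i12 j12.
by rewrite /form_env /= ed em; case: leqP => // _; rewrite formC.
Qed.

Lemma veval_small u : lin u -> veval t product_env u = veval t b u.
Proof.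
move=> lu; apply: eq_veval => k /leq_trans/(_ lu) k12.
by rewrite product_env_small.
Qed.

Lemma set_sym_ok (V : lmodType (coef N)) (B : N -> N -> V) f T i j r :
  (forall u v, B u v = B v u) -> table_ok t B b f T -> (i < 12)%N -> (j < 12)%N ->
  B (b i) (b j) = veval t f r -> table_ok t B b f (set_sym T i j r).
Proof.
move=> BC TP i12 j12 e k l k12 l12; rewrite /set_sym !entry_set //.
case: andP => [[/eqP -> /eqP ->]|_]; first by rewrite BC.
by case: andP => [[/eqP -> /eqP ->]|_] //; rewrite TP.
Qed.

(** The three fusion rules are stated for b_g = 192 a, which turns the eigenvalue 1/4 into 48. The
    third is quantitative, because the form determines the a-component of a product. *)
Hypothesis fusion00 : forall g u w, (g < 6)%N ->
  b g ** u = 0 -> b g ** w = 0 -> b g ** (u ** w) = 0.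
Hypothesis fusion04 : forall g u w, (g < 6)%N ->
  b g ** u = 0 -> b g ** w = zval 48%ZZ *: w ->
  b g ** (u ** w) = zval 48%ZZ *: (u ** w).
Hypothesis fusion44 : forall g u w, (g < 6)%N ->
  b g ** u = zval 48%ZZ *: u -> b g ** w = zval 48%ZZ *: w ->
  zval 4%ZZ *: (b g ** (u ** w)) = <[u, w]> *: b g.

Section State.
Variable st : state.
Hypothesis st_ok : state_ok st.

Lemma mulE u w : lin u -> lin w ->
  veval t b u ** veval t b w = veval t product_env (mulv st.1 u w).
Proof.
move=> lu lw; apply: veval_mulv => //; last by case: st_ok.
  exact: amul_linl.
by move=> *; exact: amul_linr.
Qed.

Lemma formE u w : lin u -> lin w ->
  <[veval t b u, veval t b w]> = veval t form_env (mulv st.2 u w).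
Proof.
move=> lu lw.
apply: (veval_mulv (B := @aform R N : N -> N -> (coef N)^o)) => //; last by case: st_ok.
  exact: aform_linl.
by move=> *; exact: aform_linr.
Qed.

Lemma entryE i j : (i < 12)%N -> (j < 12)%N -> lin (entry st.1 i j) ->
  b i ** b j = veval t b (entry st.1 i j).
Proof. by move=> i12 j12 l; case: st_ok => -> // _; rewrite veval_small. Qed.

Lemma lin_unit k : (k < 12)%N -> lin (unit_vec k).
Proof. by rewrite /lin /unit_vec size_ncons addn1. Qed.

Lemma form_step_ok x st' : form_step st x = Some st' -> state_ok st'.
Proof.
rewrite /form_step; case: st st_ok mulE formE entryE => M F MF_ok mE fE eE.
case: x => [|p [|q [|r [|i [|j [|]]]]]] //; case: ifP => //.
move=> /and5P[p12 q12 r12 i12 /and3P[j12 l1 l2]].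
case e: vsolve => [s|//] [<-].
have [|fs _] := vsolveP (t := t) (iota N) (f := form_env) _ e; last first.
  case: MF_ok => /= M_ok F_ok; split=> //=; apply: set_sym_ok => //.
  by rewrite -form_env_pair.
rewrite vevalB -[F]/((M, F).2) -!fE ?lin_unit // !veval_unit.
rewrite -[M]/((M, F).1) -!eE //.
by case: Nform => _ _ -> _; rewrite subrr.
Qed.

Lemma is_eigvP g u : (g < 6)%N -> is_eigv st.1 g u ->
  b g ** veval t b u.2 = if u.1 then zval 48%ZZ *: veval t b u.2 else 0.
Proof.
move=> g6 /andP[lu /nilP e]; have g12 : (g < 12)%N by apply: leq_trans g6 _.
have := congr1 (veval t product_env) e.
rewrite vevalB -mulE ?lin_unit // veval_unit => /eqP; rewrite subr_eq0 => /eqP ->.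
case: u.1 => //; rewrite vevalZ veval_small //.
by rewrite /= mulr0 addr0.
Qed.

(** The sum of the terms lies in the span, so its product with the axis can be expanded formally;
    the fusion rules give the same product term by term. *)
Lemma group_relP x : group_ok st x -> veval t product_env (group_rel st x) = 0.
Proof.
case: x => g ts /and3P[/= g6 ok l].
have g12 : (g < 12)%N by apply: leq_trans g6 _.
rewrite /group_rel vevalB vevalZ /= mulr0 addr0 -mulE ?lin_unit //.
rewrite veval_unit -veval_small // !veval_sum (amul_sumr Ncomm) scaler_sumr !big_map.
rewrite !(big_nth (0%ZZ, (true, [::]), (true, [::]))) -sumrB big_seq_cond.
rewrite big1 // => k /andP[]; rewrite mem_index_iota => /= ks _.
have {ok} : term_ok st g (nth (0%ZZ, (true, [::]), (true, [::])) ts k).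
  exact: all_nthP.
case: (nth _ ts k) => [[c u] w] /and3P[eu ew sf].
have lu : lin u.2 by case/andP: eu.
have lw : lin w.2 by case/andP: ew.
rewrite /term_val /term_rhs vevalZ -mulE // (amulZr Ncomm).
move: (is_eigvP g6 eu) (is_eigvP g6 ew) sf.
have pc d : peval [:: d] = zval d by rewrite /= mulr0 addr0.
(* The factor 4 in [group_rel], which clears the denominator in the rule for two eigenvectors for
   1/4, turns the eigenvalue 48 into 192. *)
have rhs04 : zval 48%ZZ *: (veval t b u.2 ** veval t b w.2) =
    b g ** (veval t b u.2 ** veval t b w.2) ->
  zval 4%ZZ *: (peval [:: c] *: (b g ** (veval t b u.2 ** veval t b w.2))) -
  veval t product_env (vscale [:: Z.mul 192 c] (mulv st.1 u.2 w.2)) = 0.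
  move=> <-; rewrite vevalZ -mulE // !pc !scalerA -scalerBl -!zvalM.
  by rewrite Z.mul_shuffle0 subrr scale0r.
case: u.1; case: w.1; lazy beta iota => U W sf.
- rewrite vevalZ veval_unit product_env_small // pevalZ pc.
  rewrite scalerA [_ * zval c]mulrC -!scalerA fusion44 // formE //.
  case: mulv sf => [|p [|]] //= _; rewrite ?addr0.
    by rewrite !scale0r scaler0 subrr.
  by rewrite [_ *: 1]mulr1 subrr.
- by apply: rhs04; rewrite [veval _ _ u.2 ** _](amulC Ncomm) fusion04.
- by apply: rhs04; rewrite fusion04.
- by rewrite fusion00 // !scaler0 subrr.
Qed.

Lemma mul_step_ok gs i j st' : mul_step st gs i j = Some st' -> state_ok st'.
Proof.
rewrite /mul_step; case: ifP => // /and3P[i12 j12 /allP ok].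
case e: vsolve => [s|//] [<-].
have [|fs _] := vsolveP (t := t) (iota N) (f := product_env) _ e.
  rewrite veval_sum big_map big_seq big1 // => x /ok; exact: group_relP.
case: st_ok => M_ok F_ok; split=> //=; apply: set_sym_ok => //.
  by case: Ncomm.
by rewrite -product_env_pair.
Qed.

Lemma exec_ok s st' : exec st s = Some st' -> state_ok st'.
Proof.
by case: s => [x|[[gs i] j]] /=; [exact: form_step_ok | exact: mul_step_ok].
Qed.

End State.

Lemma run_ok st l st' : state_ok st -> run st l = Some st' -> state_ok st'.
Proof.
rewrite /run; elim: l st => [|s l IH] st st_ok /=; first by case=> <-.
case e: (exec st s) => [st1|]; first exact/IH/(exec_ok st_ok e).
by elim: l {IH}.
Qed.

End Derivation.

Lemma ord3P (P : 'I_3 -> Prop) : P i1 -> P i2 -> P i3 -> forall i, P i.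
Proof.
move=> p1 p2 p3 [[|[|[|]]] //= h].
- by rewrite (_ : Ordinal h = i1) //; apply: val_inj.
- by rewrite (_ : Ordinal h = i2) //; apply: val_inj.
- by rewrite (_ : Ordinal h = i3) //; apply: val_inj.
Qed.

Variant basis_index_spec : nat -> Prop :=
| AxisIndex (i : 'I_3) e : basis_index_spec (ax i e)
| IdemIndex (i : 'I_3) : basis_index_spec (vopp i)
| ProdIndex (i : 'I_3) : basis_index_spec (xx i).

Lemma basis_indexP k : (k < 12)%N -> basis_index_spec k.
Proof.
do 12?[case: k => [|k]] => // _.
- exact: (AxisIndex i1 true). - exact: (AxisIndex i1 false).
- exact: (AxisIndex i2 true). - exact: (AxisIndex i2 false).
- exact: (AxisIndex i3 true). - exact: (AxisIndex i3 false).
- exact: (IdemIndex i3). - exact: (IdemIndex i2). - exact: (IdemIndex i1).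
- exact: (ProdIndex i1). - exact: (ProdIndex i2). - exact: (ProdIndex i3).
Qed.

Lemma axis_indexP g : (g < 6)%N -> exists (i : 'I_3) e, g = ax i e.
Proof.
do 6?[case: g => [|g]] => // _.
- by exists i1, true. - by exists i1, false.
- by exists i2, true. - by exists i2, false.
- by exists i3, true. - by exists i3, false.
Qed.

Lemma mul0C i j : mul0 i j = mul0 j i.
Proof. by rewrite /mul0 minnC maxnC. Qed.

Lemma form0C i j : form0 i j = form0 j i.
Proof. by rewrite /form0 minnC maxnC. Qed.

Lemma entry_mk f i j : (i < 12)%N -> (j < 12)%N -> entry (mk_table f) i j = f i j.
Proof.
move=> i12 j12.
have s : (12 * i + j < 144)%N.
  apply: (@leq_trans (12 * i.+1)); rewrite ?mulnSr ?ltn_add2l //.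
  by rewrite -mulnSr (leq_mul2l 12 _ 12).
rewrite /entry (nth_map 0%N) ?size_iota // nth_iota // add0n.
by rewrite mulnC divnMDl // divn_small // addn0 modnMDl modn_small.
Qed.

Section ScaledBasis.
Variables (R : realType) (N : markedAlg R).

Definition sbasis (k : nat) : N := zval (coef N) 192%ZZ *: nth 0 (basis12 N) k.

End ScaledBasis.

(** * The idempotents of the 4A subalgebras *)

Section Vax.
Variables (R : realType) (N : markedAlg R).
Local Notation "u ** v" := (@amul R N u v) (at level 40, left associativity).
Local Notation zval := (@zval (coef N)).

Lemma inv_zval (p : positive) : iota N (Pos.to_nat p)%:R^-1 * zval (Zpos p) = 1.
Proof. exact: (zval_inv (iota N) (c := Zpos p)). Qed.

(** The 4A product formula can be solved for its idempotent. Hence the unspecified idempotents of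
    [shape4A] are the explicit elements [vax]. *)
Lemma vax_product (i j : 'I_3) v :
  gen N (i, true) ** gen N (j, true) = iota N 64^-1 *:
    (3 *: gen N (i, true) + 3 *: gen N (j, true) + gen N (i, false)
     + gen N (j, false) - 3 *: v) ->
  vax N i j = v.
Proof.
move=> ab; rewrite /vax ab scalerA -rmorphM.
have -> : 2 ^+ 6 / 3 / 64 = 3^-1 :> R.
  by rewrite mulrAC -natrX divff ?mul1r // pnatr_eq0.
have i3 : iota N 3^-1 * 3 = 1 by rewrite -[RHS](inv_zval 3) zval_pos.
rewrite scalerBr !scalerDr !scalerA i3 !scale1r; set x := gen N _ + _ + _ + _.
by rewrite opprB addrC subrK.
Qed.

Lemma vaxC (i j : 'I_3) : is_comm_algebra N -> vax N i j = vax N j i.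
Proof.
case=> mC _.
by rewrite /vax mC [gen N (i, _) + _]addrC -!addrA [X in _ + (_ + X)]addrCA.
Qed.

End Vax.

(** * Fusion rules and initial tables in a member of the class *)

Section Member.
Variables (R : realType) (N : markedAlg R).
Hypothesis Nclass :
  [/\ is_primitive_frobenius_axial N, property_P N & shape4A N].

Local Notation "u ** v" := (@amul R N u v) (at level 40, left associativity).
Local Notation "<[ u , v ]>" := (@aform R N u v).
Local Notation zval := (@zval (coef N)).
Local Notation b := (@sbasis R N).

Lemma Ncomm : is_comm_algebra N. Proof. by case: Nclass => -[]. Qed.
Lemma Nform : is_frobenius_form N. Proof. by case: Nclass => -[]. Qed.
Lemma Naxis g : is_axis (gen N g).
Proof. by case: Nclass => -[_ _ /(_ g)[]]. Qed.
Lemma Nprim g : is_primitive (gen N g).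
Proof. by case: Nclass => -[_ _ /(_ g)[]]. Qed.
Lemma Nnorm g : <[gen N g, gen N g]> = 1.
Proof. by case: Nclass => -[_ _ /(_ g)[]]. Qed.

Let mC := amulC Ncomm.
Let mZl := amulZl Ncomm.
Let fZl := aformZl Nform.
Let fZr := aformZr Nform.

(* The algebra is spanned by products, on which the form is symmetric because
   <xy, z> = <x, yz> = <z, xy>. *)
Lemma member_formC u v : <[u, v]> = <[v, u]>.
Proof.
case: Nform => fl fr fA _; case: Nclass => -[_ _ _ gen_all] _ _.
have prodC x y z : <[x ** y, z]> = <[z, x ** y]>.
  by rewrite -fA (fA z) (mC z x) -fA (mC z y).
apply: (gen_all u (fun u => forall v, <[u, v]> = <[v, u]>)); last first.
  by move=> _ [g ->] w; case: (Naxis g) => <- _ _ _; exact: prodC.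
split=> [w|c x y Ux Uy w|x y _ _ w]; last exact: prodC.
  by rewrite -(scale0r 0) fZl fZr !mul0r.
by rewrite fl fr Ux Uy.
Qed.

Lemma fusion_sing g l m n u v : mstar l m = [:: n] ->
  eigenspace (gen N g) l u -> eigenspace (gen N g) m v ->
  eigenspace (gen N g) n (u ** v).
Proof.
case: (Naxis g) => _ _ _ fus lm ul vm; have := fus _ _ _ _ ul vm; rewrite lm.
by case=> f fE ->; rewrite big_seq1.
Qed.

(** By primitivity uv = c a + f with a f = 0, so that a(uv) = c a. Here <a, f> = <a a, f> = <a, a f>
    = 0, whence c = <a, uv> = <au, v> = <u, v> / 4. *)
Lemma fusion_quarter g u v :
  eigenspace (gen N g) ev4 u -> eigenspace (gen N g) ev4 v ->
  gen N g ** (u ** v) = (iota N 4^-1 * <[u, v]>) *: gen N g.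
Proof.
case: (Naxis g) => gg _ _ fus u4 v4; case: (fus _ _ _ _ u4 v4) => f fE uv.
have [c f1] := (Nprim g (f ev1)).1 (fE ev1).
have f0 := fE ev0; rewrite /eigenspace /= rmorph0 scale0r in f0.
have uvE : u ** v = c *: gen N g + f ev0.
  by rewrite uv /= !big_cons big_nil addr0 f1.
case: (Nform) => fl fr fA _.
have -> : gen N g ** (u ** v) = c *: gen N g.
  by rewrite uvE (amul_linr Ncomm) f0 addr0 gg.
congr (_ *: _); rewrite -fZl -[_ *: u]u4 -fA uvE fr Nnorm mulr1.
by rewrite -{1}gg -fA f0 -(scale0r 0) fZr mul0r addr0.
Qed.

Lemma sbasis_ax (i : 'I_3) e : b (ax i e) = zval 192%ZZ *: gen N (i, e).
Proof. by elim/ord3P: i; case: e. Qed.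

Lemma sbasis_vopp (i j k : 'I_3) : uniq [:: i; j; k] -> (j < k)%N ->
  b (vopp i) = zval 192%ZZ *: vax N j k.
Proof. by elim/ord3P: i; elim/ord3P: j; elim/ord3P: k. Qed.

Lemma sbasis_vx (i j : 'I_3) : (i < j)%N ->
  b (vx i j) = zval 192%ZZ *: vax N i j.
Proof. by elim/ord3P: i; elim/ord3P: j. Qed.

Lemma sbasis_xx (i j k : 'I_3) : uniq [:: i; j; k] -> (j < k)%N ->
  b (xx i) = zval 192%ZZ *: (gen N (i, true) ** vax N j k).
Proof. by elim/ord3P: i; elim/ord3P: j; elim/ord3P: k. Qed.

Let z192I (x y : N) : zval 192%ZZ *: x = zval 192%ZZ *: y -> x = y.
Proof. exact: (zval_inj (iota N)). Qed.

Lemma axis_index g : (g < 6)%N -> exists h, b g = zval 192%ZZ *: gen N h.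
Proof.
by move=> /axis_indexP[i [e ->]]; exists (i, e); rewrite sbasis_ax.
Qed.

Lemma eigen0P g h u : b g = zval 192%ZZ *: gen N h ->
  b g ** u = 0 <-> eigenspace (gen N h) ev0 u.
Proof.
move=> ->; rewrite /eigenspace /= rmorph0 scale0r mZl.
split=> [e|->]; last exact: scaler0.
by apply: z192I; rewrite e scaler0.
Qed.

Lemma eigen4P g h u : b g = zval 192%ZZ *: gen N h ->
  b g ** u = zval 48%ZZ *: u <-> eigenspace (gen N h) ev4 u.
Proof.
move=> ->; rewrite /eigenspace /= mZl.
have -> : zval 48%ZZ *: u = zval 192%ZZ *: ((iota N 4^-1) *: u).
  rewrite scalerA (zvalM _ 48%ZZ 4%ZZ : zval 192%ZZ = _) mulrAC -mulrA.
  by rewrite (inv_zval N 4) mulr1.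
by split=> [/z192I|->].
Qed.

Lemma member_fusion00 g u w : (g < 6)%N ->
  b g ** u = 0 -> b g ** w = 0 -> b g ** (u ** w) = 0.
Proof.
move=> /axis_index[h e]; rewrite !(eigen0P _ e); exact: fusion_sing.
Qed.

Lemma member_fusion04 g u w : (g < 6)%N ->
  b g ** u = 0 -> b g ** w = zval 48%ZZ *: w ->
  b g ** (u ** w) = zval 48%ZZ *: (u ** w).
Proof.
move=> /axis_index[h e]; rewrite (eigen0P _ e) !(eigen4P _ e); exact: fusion_sing.
Qed.

Lemma member_fusion44 g u w : (g < 6)%N ->
  b g ** u = zval 48%ZZ *: u -> b g ** w = zval 48%ZZ *: w ->
  zval 4%ZZ *: (b g ** (u ** w)) = <[u, w]> *: b g.
Proof.
move=> /axis_index[h e]; rewrite !(eigen4P _ e) => u4 w4.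
rewrite e mZl fusion_quarter // !scalerA mulrA; congr (_ *: _).
rewrite [zval 4%ZZ * zval _]mulrC -!mulrA (mulrA (zval 4%ZZ)) [zval 4%ZZ * _]mulrC.
by rewrite (inv_zval N 4) mul1r mulrC.
Qed.

Lemma vax_type4A (i j : 'I_3) : i != j -> type4A i j (vax N i j).
Proof.
case: Nclass => _ _ [v [vC /(_ i j)] ij4 ij]; have := ij4 ij.
suff -> : v i j = vax N i j by [].
by case: (ij4 ij) => _ _ [/(_ true true)/vax_product -> _ _ _ _].
Qed.

End Member.

Section Member.
Variables (R : realType) (N : markedAlg R).
Hypothesis Nclass :
  [/\ is_primitive_frobenius_axial N, property_P N & shape4A N].

Local Notation "u ** v" := (@amul R N u v) (at level 40, left associativity).
Local Notation "<[ u , v ]>" := (@aform R N u v).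
Local Notation zval := (@zval (coef N)).
Local Notation b := (@sbasis R N).
Local Notation t := (tpar N).
Let mC := amulC (Ncomm Nclass).
Let mZr := amulZr (Ncomm Nclass).
Let mZl := amulZl (Ncomm Nclass).
Let fZl := aformZl (Nform Nclass).
Let fZr := aformZr (Nform Nclass).

Lemma inv_scale (p : positive) (x y : N) :
  x = iota N (Pos.to_nat p)%:R^-1 *: y -> zval (Zpos p) *: x = y.
Proof. by move=> ->; rewrite scalerA mulrC inv_zval scale1r. Qed.

Lemma ax_lt12 (i : 'I_3) e : (ax i e < 12)%N.
Proof. by elim/ord3P: i; case: e. Qed.
Lemma vx_lt12 (i j : 'I_3) : (vx i j < 12)%N.
Proof. by elim/ord3P: i; elim/ord3P: j. Qed.
Lemma vopp_lt12 (i : 'I_3) : (vopp i < 12)%N.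
Proof. by elim/ord3P: i. Qed.
Lemma xx_lt12 (i : 'I_3) : (xx i < 12)%N.
Proof. by elim/ord3P: i. Qed.

Lemma axis_mul_axis (i j : 'I_3) e d : (i < j)%N ->
  b (ax i e) ** b (ax j d) = veval t (product_env b) (mul0 (ax i e) (ax j d)).
Proof.
move=> ij; have nij : i != j by rewrite neq_ltn ij.
have -> : mul0 (ax i e) (ax j d) = axis_axis i e j d.
  by elim/ord3P: i ij {nij}; elim/ord3P: j; case: e; case: d.
rewrite veval_comb !big_cons big_nil /= !product_env_small ?ax_lt12 ?vx_lt12 //.
rewrite !sbasis_ax sbasis_vx //; apply: (@zval_inj _ _ (iota N) _ 64%ZZ) => //.
case: (vax_type4A Nclass nij) => _ _ [/(_ e d) /(inv_scale (p := 64)) ab _ _ _ _] _ _.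
transitivity (zval (192 * 192)%ZZ *: (zval 64%ZZ *: (gen N (i, e) ** gen N (j, d)))).
  by rewrite mZl mZr !scalerA -!zvalM.
rewrite ab -scaleNr addr0 -(zval_pos _ 3) -zvalN; set v := vax N i j.
by rewrite !scalerDr !scalerA -!zvalM -!addrA.
Qed.

Lemma sbasis_vx_neq (i j : 'I_3) : i != j -> b (vx i j) = zval 192%ZZ *: vax N i j.
Proof.
rewrite neq_ltn => /orP[|ij]; first exact: sbasis_vx.
by rewrite /vx addnAC (vaxC i j (Ncomm Nclass)) -sbasis_vx.
Qed.

Lemma axis_mul_idem (i j : 'I_3) e : i != j ->
  b (ax i e) ** b (vx i j) = veval t (product_env b) (mul0 (ax i e) (vx i j)).
Proof.
move=> ij.
have -> : mul0 (ax i e) (vx i j) = axis_idem4A i e j.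
  by elim/ord3P: i ij; elim/ord3P: j; case: e.
rewrite veval_comb !big_cons big_nil /= !product_env_small ?ax_lt12 ?vx_lt12 //.
rewrite !sbasis_ax sbasis_vx_neq //; apply: (@zval_inj _ _ (iota N) _ 16%ZZ) => //.
case: (vax_type4A Nclass ij) => _ _ [_ /(_ e) /(inv_scale (p := 16)) av _ _ _] _ _.
set v := vax N i j in av *.
transitivity (zval (192 * 192)%ZZ *: (zval 16%ZZ *: (gen N (i, e) ** v))).
  by rewrite mZl mZr !scalerA -!zvalM.
rewrite av -!scaleNr addr0 -(zval_pos _ 5) -(zval_pos _ 2).
rewrite -(zval_pos _ 3) -scaleN1r -(zval1 (coef N)) -!zvalN.
by rewrite !scalerDr !scalerA -!zvalM -!addrA.
Qed.

Lemma vopp_vx (i m : 'I_3) : i != m -> exists2 j : 'I_3, i != j & vopp m = vx i j.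
Proof.
elim/ord3P: i; elim/ord3P: m => // _;
  by [exists i1 | exists i2 | exists i3].
Qed.

Lemma vopp_pair (m : 'I_3) : exists i j : 'I_3, i != j /\ vopp m = vx i j.
Proof.
by elim/ord3P: m; [exists i2, i3 | exists i1, i3 | exists i1, i2].
Qed.

Lemma mul0_known i j : (i <= j < 12)%N ->
  b i ** b j = veval t (product_env b) (mul0 i j).
Proof.
have unknown k l u : (k < 12)%N -> (l < 12)%N ->
    u = unit_vec (12 + pair_index k l) ->
    b k ** b l = veval t (product_env b) u.
  by move=> k12 l12 ->; rewrite veval_unit product_env_pair //; exact: Ncomm.
have single k c : (k < 12)%N ->
    veval t (product_env b) (zvcomb [:: (c, k)]) = zval c *: b k.
  by move=> k12; rewrite veval_comb big_seq1 product_env_small.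
move=> /andP[ij j12]; have i12 := leq_ltn_trans ij j12.
case: (basis_indexP j12) ij => [j' d|m|m] ij; last 1 first.
- apply: unknown => //; rewrite ?xx_lt12 //.
  case: (basis_indexP i12) ij => [i' e|m'|m'] ij.
  + by elim/ord3P: m ij; elim/ord3P: i'; case: e.
  + by elim/ord3P: m ij; elim/ord3P: m'.
  + by elim/ord3P: m ij; elim/ord3P: m'.
- case: (basis_indexP i12) ij => [i' e|m'|m'] ij.
  + have [ij'|ne] := eqVneq i' j'.
      rewrite -{}ij' in ij *; case: (eqVneq e d) => [<-|ed].
        have -> : mul0 (ax i' e) (ax i' e) = zvcomb [:: (192%ZZ, ax i' e)].
          by elim/ord3P: i' {ij}; case: e.
        rewrite single ?ax_lt12 // !sbasis_ax mZl mZr.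
        by case: (Naxis Nclass (i', e)) => ->.
      have -> : mul0 (ax i' e) (ax i' d) = [::].
        by elim/ord3P: i' {ij}; case: e ed; case: d.
      (* The product of opposite axes is prescribed only inside a 4A subalgebra, so a second index
         has to be chosen. *)
      have [k ik] : exists k : 'I_3, i' != k.
        by elim/ord3P: i' {ij}; [exists i2 | exists i1 | exists i1].
      case: (vax_type4A Nclass ik) => _ _ [_ _ _ aa _] _ _.
      rewrite !sbasis_ax mZl mZr.
      by case: e ed ij; case: d => // _ _;
         rewrite ?[gen N (_, false) ** _]mC aa !scaler0.
    apply: axis_mul_axis; rewrite ltn_neqAle ne /=.
    by elim/ord3P: i' ij {ne}; elim/ord3P: j'; case: e; case: d.
  + by elim/ord3P: m' ij; elim/ord3P: j'; case: d.
  + by elim/ord3P: m' ij; elim/ord3P: j'; case: d.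
- case: (basis_indexP i12) ij => [i' e|m'|m'] ij.
  + have [<-|im] := eqVneq i' m; last first.
      by have [k ik ->] := vopp_vx im; exact: axis_mul_idem.
    case: e {ij}; last first.
      by apply: unknown; rewrite ?ax_lt12 ?vopp_lt12 //; elim/ord3P: i'.
    have -> : mul0 (ax i' true) (vopp i') = zvcomb [:: (192%ZZ, xx i')].
      by elim/ord3P: i'.
    rewrite single ?xx_lt12 // sbasis_ax.
    have [j'' [k [u jk]]] : exists j k : 'I_3, uniq [:: i'; j; k] /\ (j < k)%N.
      by elim/ord3P: i'; [exists i2, i3 | exists i1, i3 | exists i1, i2].
    by rewrite (sbasis_vopp _ u) // (sbasis_xx _ u) // mZl mZr.
  + have [->|mm] := eqVneq m' m; last first.
      apply: unknown; rewrite ?vopp_lt12 //.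
      by elim/ord3P: m' mm {ij}; elim/ord3P: m.
    have -> : mul0 (vopp m) (vopp m) = zvcomb [:: (192%ZZ, vopp m)].
      by elim/ord3P: m {ij}.
    rewrite single ?vopp_lt12 //; have [i' [j' [ij' ->]]] := vopp_pair m.
    rewrite sbasis_vx_neq // mZl mZr.
    by case: (vax_type4A Nclass ij') => ->.
  + by elim/ord3P: m' ij; elim/ord3P: m.
Qed.

Lemma form0_known i j : (i <= j < 12)%N ->
  <[b i, b j]> = veval t (form_env b) (form0 i j).
Proof.
have unknown k l u : (k < 12)%N -> (l < 12)%N ->
    u = unit_vec (1 + pair_index k l) ->
    <[b k, b l]> = veval t (form_env b) u.
  by move=> k12 l12 ->; rewrite veval_unit form_env_pair //; exact: member_formC.
have scE c : veval t (form_env b) (sc c) = zval c.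
  by rewrite veval_comb big_seq1 [_ *: _]mulr1.
move=> /andP[ij j12]; have i12 := leq_ltn_trans ij j12.
case: (basis_indexP j12) ij => [j' d|m|m] ij; last 1 first.
- apply: unknown => //; rewrite ?xx_lt12 //.
  case: (basis_indexP i12) ij => [i' e|m'|m'] ij.
  + by elim/ord3P: m ij; elim/ord3P: i'; case: e.
  + by elim/ord3P: m ij; elim/ord3P: m'.
  + by elim/ord3P: m ij; elim/ord3P: m'.
- case: (basis_indexP i12) ij => [i' e|m'|m'] ij.
  + rewrite !sbasis_ax fZl fZr; have [ij'|ne] := eqVneq i' j'.
      rewrite -{}ij' in ij *; case: (eqVneq e d) => [<-|ed].
        have -> : form0 (ax i' e) (ax i' e) = sc 36864%ZZ.
          by elim/ord3P: i' {ij}; case: e.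
        by rewrite scE (Nnorm Nclass) mulr1 -zvalM.
      have -> : form0 (ax i' e) (ax i' d) = [::].
        by elim/ord3P: i' {ij}; case: e ed; case: d.
      have [k ik] : exists k : 'I_3, i' != k.
        by elim/ord3P: i' {ij}; [exists i2 | exists i1 | exists i1].
      case: (vax_type4A Nclass ik) => _ _ _ [_ aa _] _.
      by case: e ed ij; case: d => // _ _;
         rewrite ?[<[gen N (_, false), _]>](member_formC Nclass) aa !mulr0.
    have -> : form0 (ax i' e) (ax j' d) = sc 1152%ZZ.
      by elim/ord3P: i' ij ne; elim/ord3P: j'; case: e; case: d.
    rewrite scE; case: (vax_type4A Nclass ne) => _ _ _ [-> _ _] _.
    rewrite mulrA -zvalM [zval _](zvalM _ 1152%ZZ 32%ZZ) -mulrA [zval 32%ZZ * _]mulrC.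
    by rewrite (inv_zval N 32) mulr1.
  + by elim/ord3P: m' ij; elim/ord3P: j'; case: d.
  + by elim/ord3P: m' ij; elim/ord3P: j'; case: d.
- case: (basis_indexP i12) ij => [i' e|m'|m'] ij.
  + have [<-|im] := eqVneq i' m; last first.
      have [k ik ->] := vopp_vx im.
      have -> : form0 (ax i' e) (vx i' k) = sc 13824%ZZ.
        by elim/ord3P: i' ik {ij im}; elim/ord3P: k; case: e.
      rewrite scE sbasis_ax sbasis_vx_neq // fZl fZr.
      case: (vax_type4A Nclass ik) => _ _ _ _ [-> _ _].
      rewrite rmorphM (rmorph_nat (iota N) 3) -(zval_pos _ 3) mulrA -zvalM mulrA -zvalM.
      rewrite [zval _](zvalM _ 13824%ZZ 8%ZZ) -mulrA [zval 8%ZZ * _]mulrC.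
      by rewrite (inv_zval N 8) mulr1.
    case: (eqVneq (ax i' e) 0%N) => [i0|i0]; last first.
      apply: unknown; rewrite ?ax_lt12 ?vopp_lt12 //.
      by elim/ord3P: i' i0 {ij}; case: e.
    have [-> ->] : i' = i1 /\ e = true by elim/ord3P: i' i0 {ij}; case: e.
    have -> : form0 (ax i1 true) (vopp i1) = [:: [:: 0; 36864]]%ZZ by [].
    rewrite sbasis_ax (@sbasis_vopp _ _ i1 i2 i3) // fZl fZr mulrA -zvalM.
    by rewrite /= zval0 mulr0 !addr0 add0r [_ *: _]mulr1 mulrC.
  + have [->|mm] := eqVneq m' m; last first.
      apply: unknown; rewrite ?vopp_lt12 //.
      by elim/ord3P: m' mm {ij}; elim/ord3P: m.
    have -> : form0 (vopp m) (vopp m) = sc 73728%ZZ by elim/ord3P: m {ij}.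
    have [i' [j' [ij' ->]]] := vopp_pair m.
    rewrite scE sbasis_vx_neq // fZl fZr.
    case: (vax_type4A Nclass ij') => _ _ _ _ [_ _ ->].
    by rewrite -(zval_pos _ 2) -!zvalM.
  + by elim/ord3P: m' ij; elim/ord3P: m.
Qed.

Lemma state0_ok : state_ok b t state0.
Proof.
split=> i j i12 j12; rewrite entry_mk //.
  case: (leqP i j) => [ij|/ltnW ji]; first by rewrite mul0_known // ij.
  by rewrite mC mul0C mul0_known // ji.
case: (leqP i j) => [ij|/ltnW ji]; first by rewrite form0_known // ij.
by rewrite (member_formC Nclass) form0C form0_known // ji.
Qed.

Lemma final_ok : state_ok b t final.
Proof.
apply: (run_ok (Ncomm Nclass) (Nform Nclass) (member_formC Nclass) _ _ _
          state0_ok (l := steps)).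
- exact: member_fusion00.
- exact: member_fusion04.
- exact: member_fusion44.
by vm_compute.
Qed.

End Member.

(** * The algebras given by the tables belong to the class *)

Definition zeq (u w : zvec) : bool := (u : seq (seq Z)) == w.

Lemma zeqP u w : zeq u w -> u = w.
Proof. exact: eqP. Qed.

Lemma all_iotaP (P : pred nat) n :
  reflect (forall k, (k < n)%N -> P k) (all P (seq.iota 0 n)).
Proof.
by apply: (iffP allP) => h k; [move=> kn; apply: h|move=> kn; apply: h];
  rewrite mem_iota in kn *.
Qed.

Definition all_pairs (f : nat -> nat -> bool) : bool :=
  all (fun i => all (fun j => (i == j) || f i j) (seq.iota 0 3)) (seq.iota 0 3).

Lemma all_pairsP f (i j : 'I_3) : all_pairs f -> i != j -> f i j.
Proof.
move=> /all_iotaP/(_ i (ltn_ord i))/all_iotaP/(_ j (ltn_ord j)) /orP[/eqP ij|//].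
by move/eqP => []; apply: val_inj.
Qed.

(* The eigenvalues of 192 times an axis. *)
Definition zeval (l : monster) : Z :=
  match l with ev1 => 192 | ev0 => 0 | ev4 => 48 | ev32 => 6 end%ZZ.
Definition others (l : monster) : seq monster :=
  match l with
  | ev1 => [:: ev0; ev4; ev32] | ev0 => [:: ev1; ev4; ev32]
  | ev4 => [:: ev1; ev0; ev32] | ev32 => [:: ev1; ev0; ev4]
  end.
Definition zshift (g : nat) (l : monster) (u : zvec) : zvec :=
  vsub (mulv mul_table (unit_vec g) u) (vscale [:: zeval l] u).
(** The product over L of the operators (multiplication by b_g) minus eigenvalue. For L = [others l]
    it is [zdiff l L] times the Lagrange projection onto the eigenspace for l. *)
Definition zkill (g : nat) (L : seq monster) (u : zvec) : zvec := foldr (zshift g) u L.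
Definition zproj g l k := zkill g (others l) (unit_vec k).
Definition zdiff (l : monster) (L : seq monster) : Z :=
  foldr (fun m c => Z.mul (Z.sub (zeval l) (zeval m)) c) 1%ZZ L.
Definition zprojs g l :=
  [seq u <- [seq zproj g l k | k <- seq.iota 0 12] | ~~ nilp u].
Definition zfusion g l m :=
  all (fun u => all (fun w => nilp (zkill g (mstar l m) (mulv mul_table u w)))
                    (zprojs g m)) (zprojs g l).

Lemma tables_lin :
  all lin mul_table /\ all (fun u => size u <= 1)%N form_table.
Proof. by vm_compute. Qed.

Lemma tables_sym :
  all (fun i => all (fun j => zeq (entry mul_table i j) (entry mul_table j i))
                    (seq.iota 0 12)) (seq.iota 0 12).
Proof. by vm_compute. Qed.

Lemma tables_frobenius :
  all (fun i => all (fun j => all (fun k =>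
         nilp (vsub (mulv form_table (unit_vec i) (entry mul_table j k))
                    (mulv form_table (entry mul_table i j) (unit_vec k))))
       (seq.iota 0 12)) (seq.iota 0 12)) (seq.iota 0 12).
Proof. by vm_compute. Qed.

(** A product of four distinct linear factors annihilates the multiplication by each axis, which is
    therefore diagonalisable. *)
Lemma zkill_all :
  all (fun g => all (fun k => nilp (zkill g monsters (unit_vec k)))
                    (seq.iota 0 12)) (seq.iota 0 6).
Proof. by vm_compute. Qed.

(** Only coordinate g survives the projection onto the eigenspace for 1: this is primitivity. *)
Lemma zproj1_axis :
  all (fun g => all (fun k =>
         (size (zproj g ev1 k) <= g.+1)%N
         && all (fun p => nilp p) (take g (zproj g ev1 k)))
       (seq.iota 0 12)) (seq.iota 0 6).
Proof. by vm_compute. Qed.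

(** The rules involving 1 follow from primitivity and the reversed ones from commutativity, so six
    pairs suffice. A product obeys its rule when the shifts by the allowed eigenvalues annihilate
    it. *)
Lemma zfusion_all :
  all (fun g => [&& zfusion g ev0 ev0, zfusion g ev0 ev4, zfusion g ev4 ev4,
                    zfusion g ev0 ev32, zfusion g ev4 ev32 &
                    zfusion g ev32 ev32]) (seq.iota 0 6).
Proof. by vm_compute. Qed.

(** 46872 is [zdiff ev32 (others ev32)], the factor between [zproj] and the true projection. Twice
    the component of a_j for 1/32 is thus a_j - a_-j, or zero when j = i. *)
Lemma zproj_miyamoto :
  all (fun i => all (fun e => all (fun j => all (fun d =>
         nilp (vsub (vscale [:: 2%ZZ] (zproj (ax i e) ev32 (ax j d)))
                    (if i == j then [::] else
                     vscale [:: 46872%ZZ] (vsub (unit_vec (ax j d))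
                                                (unit_vec (ax j (~~ d)))))))
       [:: true; false]) (seq.iota 0 3)) [:: true; false]) (seq.iota 0 3).
Proof. by vm_compute. Qed.

(* [zweight l / 35997696] is the inverse of [zdiff l (others l)]. *)
Definition zweight (l : monster) : Z :=
  match l with ev1 => 7 | ev0 => -651 | ev4 => -124 | ev32 => 768 end%ZZ.

(** Lagrange interpolation of the constant 1 at the four eigenvalues, with denominators cleared. *)
Lemma zlagrange :
  all (fun g => all (fun k =>
         nilp (vsub (vsum [seq vscale [:: zweight l] (zproj g l k)
                          | l <- monsters])
                    (vscale [:: 35997696%ZZ] (unit_vec k))))
       (seq.iota 0 12)) (seq.iota 0 6).
Proof. by vm_compute. Qed.

Lemma zmul_known :
  all_pairs (fun i j => all (fun e =>
    [&& all (fun d => zeq (entry mul_table (ax i e) (ax j d))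
                          (axis_axis i e j d)) [:: true; false],
        zeq (entry mul_table (ax i e) (vx i j)) (axis_idem4A i e j) &
        zeq (entry mul_table (vx i j) (vx i j)) (zvcomb [:: (192%ZZ, vx i j)])])
    [:: true; false]).
Proof. by vm_compute. Qed.

Lemma zmul_axis :
  all (fun i =>
    zeq (entry mul_table (ax i true) (ax i false)) [::] &&
    zeq (entry mul_table (ax i true) (vopp i)) (zvcomb [:: (192%ZZ, xx i)]))
    (seq.iota 0 3).
Proof. by vm_compute. Qed.

Lemma zmul_square :
  all (fun g => zeq (entry mul_table g g) (zvcomb [:: (192%ZZ, g)]))
    (seq.iota 0 6).
Proof. by vm_compute. Qed.

Lemma zform_known :
  all_pairs (fun i j => all (fun e =>
    [&& all (fun d => zeq (entry form_table (ax i e) (ax j d)) (sc 1152%ZZ))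
            [:: true; false],
        zeq (entry form_table (ax i e) (vx i j)) (sc 13824%ZZ),
        zeq (entry form_table (vx i j) (vx i j)) (sc 73728%ZZ) &
        zeq (entry form_table (ax i e) (ax i (~~ e))) [::]])
    [:: true; false]).
Proof. by vm_compute. Qed.

Lemma zform_square :
  all (fun g => zeq (entry form_table g g) (sc 36864%ZZ)) (seq.iota 0 6).
Proof. by vm_compute. Qed.

Definition span4A i j :=
  [:: ax i true; ax i false; ax j true; ax j false; vx i j].
Definition supported (K : seq nat) (u : zvec) :=
  all (fun k => (k \in K) || nilp (nth [::] u k)) (seq.iota 0 12).

Lemma zspan4A :
  all_pairs (fun i j => all (fun k => all (fun l =>
    supported (span4A i j) (entry mul_table k l)) (span4A i j)) (span4A i j)).
Proof. by vm_compute. Qed.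

(* Expresses a_{-j} in terms of a_i, a_j and their products. *)
Definition generated4A i j : zvec :=
  let p := entry mul_table (ax i true) (ax j true) in
  vsub (mulv mul_table (unit_vec (ax i true)) p) (vscale [:: 48%ZZ] p).

Lemma zgenerated4A :
  all_pairs (fun i j =>
    zeq (generated4A i j)
        (zvcomb [:: (864, ax i true); (-126, ax j true);
                   (126, ax j false)]%ZZ)).
Proof. by vm_compute. Qed.

Lemma size_vcons p u : (size (vcons p u) <= (size u).+1)%N.
Proof. by rewrite /vcons; case: ifP. Qed.

Lemma size_vadd n u w : (size u <= n)%N -> (size w <= n)%N -> (size (vadd u w) <= n)%N.
Proof.
elim: u w n => [|p u IH] [|q w] [|n] //= un wn.
by apply: leq_trans (size_vcons _ _) _; rewrite ltnS IH.
Qed.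

Lemma size_vscale p u : (size (vscale p u) <= size u)%N.
Proof.
case: p => [|c p]; first by case: u.
elim: u => [|q u IH] //; apply: leq_trans (size_vcons _ _) _.
by rewrite ltnS.
Qed.

Lemma lin_lcomb u f : (forall k, lin (f k)) -> lin (lcomb u f).
Proof.
elim: u f => [|p u IH] f lf //=; apply: size_vadd; last exact: IH.
exact: leq_trans (size_vscale _ _) (lf _).
Qed.

Lemma lin_entry i j : lin (entry mul_table i j).
Proof.
rewrite /entry; have [ij|ij] := ltnP (12 * i + j) (size mul_table).
  by apply/all_nthP => //; case: tables_lin.
by rewrite nth_default.
Qed.

Lemma lin_mulv u w : lin (mulv mul_table u w).
Proof. by do 2!apply: lin_lcomb => ?; exact: lin_entry. Qed.

Lemma lin_zshift g l u : lin u -> lin (zshift g l u).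
Proof.
move=> lu; apply: size_vadd; first exact: lin_mulv.
by do 2!apply: leq_trans (size_vscale _ _) _.
Qed.

Lemma lin_zkill g L u : lin u -> lin (zkill g L u).
Proof. by move=> lu; elim: L => //= l L; exact: lin_zshift. Qed.

Lemma lin_zproj g l k : (k < 12)%N -> lin (zproj g l k).
Proof. by move=> k12; apply: lin_zkill; exact: lin_unit. Qed.

(** * Eigenspaces, fusion rules and Miyamoto involutions from the tables *)

Section Structured.
Variables (R : realType) (N : markedAlg R) (t : coef N) (b : nat -> N).

Local Notation "u ** v" := (@amul R N u v) (at level 40, left associativity).
Local Notation "<[ u , v ]>" := (@aform R N u v).
Local Notation zval := (@zval (coef N)).

(** Holds for the members of the class, for the model over R[t] and for the quotient by the kernels,
    so that facts read off the tables are proved once for all three. *)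
Definition structured : Prop :=
  [/\ is_comm_algebra N, is_frobenius_form N,
      table_ok t (@amul R N) b b mul_table,
      table_ok t (@aform R N : N -> N -> (coef N)^o) b (fun=> 1) form_table &
      forall (i : 'I_3) e, b (ax i e) = zval 192%ZZ *: gen N (i, e)].

Hypothesis Nstr : structured.
Hypothesis Nspan : forall v, exists c : nat -> coef N, v = \sum_(k < 12) c k *: b k.

Let Ncomm : is_comm_algebra N. Proof. by case: Nstr. Qed.
Let Nform : is_frobenius_form N. Proof. by case: Nstr. Qed.
Let mC := amulC Ncomm.
Let mZr := amulZr Ncomm.
Let mZl := amulZl Ncomm.
Let m0r := amul0r Ncomm.
Let m0l := amul0l Ncomm.

Lemma structured_mul u w : lin u -> lin w ->
  veval t b u ** veval t b w = veval t b (mulv mul_table u w).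
Proof.
move=> lu lw; apply: veval_mulv => //; last by case: Nstr.
  exact: amul_linl Ncomm.
by move=> *; exact: amul_linr Ncomm _ _ _ _.
Qed.

Lemma span_ind (P : N -> Prop) : P 0 ->
  (forall c u v, P u -> P v -> P (c *: u + v)) ->
  (forall k, (k < 12)%N -> P (b k)) -> forall v, P v.
Proof.
move=> P0 PD Pb v; have [c ->] := Nspan v.
elim/big_ind: _ => // [x y Px Py|k _]; first by rewrite -[x]scale1r; apply: PD.
by rewrite -[_ *: _]addr0; apply: PD => //; exact: Pb.
Qed.

Definition shift (g : nat) (l : monster) (v : N) : N := b g ** v - zval (zeval l) *: v.
Definition kill g L v := foldr (shift g) v L.

Lemma shift_lin g l c u v : shift g l (c *: u + v) = c *: shift g l u + shift g l v.
Proof.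
rewrite /shift (amul_linr Ncomm) scalerDr opprD addrACA scalerBr.
by rewrite !scalerA mulrC.
Qed.

Lemma kill_lin g L c u v : kill g L (c *: u + v) = c *: kill g L u + kill g L v.
Proof. by elim: L => //= l L ->; rewrite shift_lin. Qed.

Lemma kill0 g L : kill g L 0 = 0.
Proof. by have := kill_lin g L (-1) 0 0; rewrite scaler0 addr0 scaleN1r addNr. Qed.

Lemma killZ g L c u : kill g L (c *: u) = c *: kill g L u.
Proof. by have := kill_lin g L c u 0; rewrite kill0 !addr0. Qed.

Lemma veval_zkill g L u : (g < 12)%N -> lin u ->
  veval t b (zkill g L u) = kill g L (veval t b u).
Proof.
move=> g12 lu; elim: L => //= l L IH.
rewrite /zshift vevalB -structured_mul ?lin_unit ?lin_zkill // veval_unit vevalZ IH.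
by rewrite /= mulr0 addr0.
Qed.

Lemma veval_zproj g l k : (g < 12)%N -> (k < 12)%N ->
  veval t b (zproj g l k) = kill g (others l) (b k).
Proof. by move=> g12 k12; rewrite veval_zkill ?lin_unit // veval_unit. Qed.

Section Axis.
Variables (i : 'I_3) (e : bool).
Local Notation g := (ax i e).
Local Notation a := (gen N (i, e)).

Let g6 : (g < 6)%N. Proof. by elim/ord3P: i; case: e. Qed.
Let g12 : (g < 12)%N. Proof. by apply: leq_trans g6 _. Qed.
Let bg : b g = zval 192%ZZ *: a. Proof. by case: Nstr. Qed.

Lemma eigenspaceE l v : eigenspace a l v <-> b g ** v = zval (zeval l) *: v.
Proof.
rewrite /eigenspace bg mZl.
suff -> : zval (zeval l) *: v = zval 192%ZZ *: ((iota N (mval R l)) *: v).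
  by split=> [->|/(zval_inj (iota N))] //; apply.
rewrite scalerA; congr (_ *: v); case: l => /=.
- by rewrite rmorph1 mulr1.
- by rewrite rmorph0 mulr0 zval0.
- rewrite [zval 192%ZZ](zvalM _ 48%ZZ 4%ZZ) -mulrA [_ * iota _ _]mulrC.
  by rewrite (inv_zval N 4) mulr1.
- rewrite [zval 192%ZZ](zvalM _ 6%ZZ 32%ZZ) -mulrA [_ * iota _ _]mulrC.
  by rewrite (inv_zval N 32) mulr1.
Qed.

Lemma eigenspaceZ l c u : eigenspace a l u -> eigenspace a l (c *: u).
Proof. by rewrite !eigenspaceE mZr => ->; rewrite !scalerA mulrC. Qed.

Lemma kill_eigen l L v : eigenspace a l v -> kill g L v = zval (zdiff l L) *: v.
Proof.
move=> vl; elim: L => [|m L IH] /=; first by rewrite zval1 scale1r.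
rewrite IH /shift mZr ((eigenspaceE l v).1 vl) !scalerA -scalerBl zvalM.
by rewrite [zval (Z.sub _ _)]zvalD zvalN mulrBl mulrC.
Qed.

Lemma kill_proj l v : eigenspace a l (kill g (others l) v).
Proof.
apply/eigenspaceE/eqP; rewrite -subr_eq0 -/(shift g l _); apply/eqP.
elim/span_ind: v => [|c u v Pu Pv|k k12].
- by rewrite kill0 -[X in X = _]/(kill g [:: l] 0) kill0.
- by rewrite kill_lin shift_lin Pu Pv scaler0 addr0.
move: zkill_all => /all_iotaP/(_ _ g6)/all_iotaP/(_ _ k12)/nilP/(congr1 (veval t b)).
rewrite veval_zkill ?lin_unit // veval_unit /= => k0.
(* The shifts commute, so the factor for l can be moved to its place in the fixed order of
   [monsters]. *)
have comm l1 l2 v : shift g l1 (shift g l2 v) = shift g l2 (shift g l1 v).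
  have fB c x y : b g ** (x - c *: y) = b g ** x - c *: (b g ** y).
    by rewrite [x - _]addrC -!scaleNr (amul_linr Ncomm) addrC.
  rewrite /shift !fB !scalerBr !scalerA !opprB addrACA [RHS]addrACA.
  by congr (_ + _); [rewrite mulrC | rewrite addrC].
case: l; rewrite [kill _ _ _]/=.
- exact: k0.
- by rewrite (comm ev0 ev1) k0.
- by rewrite (comm ev4 ev1) (comm ev4 ev0) k0.
- by rewrite (comm ev32 ev1) (comm ev32 ev0) (comm ev32 ev4) k0.
Qed.

Lemma zdiff_others_neq0 l : zdiff l (others l) <> Z0.
Proof. by case: l. Qed.

Definition component l v : N :=
  iota N ((int_of_Z (zdiff l (others l)))%:~R)^-1 *: kill g (others l) v.

Lemma component_eigen l v : eigenspace a l (component l v).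
Proof. exact/eigenspaceZ/kill_proj. Qed.

Lemma component_id l v : eigenspace a l v -> component l v = v.
Proof.
move=> /kill_eigen vl; rewrite /component vl scalerA zval_inv ?scale1r //.
exact: zdiff_others_neq0.
Qed.

Lemma component_neq l m v : eigenspace a m v -> zdiff m (others l) = Z0 ->
  component l v = 0.
Proof. by move=> /kill_eigen vm d0; rewrite /component vm d0 zval0 scale0r scaler0. Qed.

Lemma component_lin l c u v :
  component l (c *: u + v) = c *: component l u + component l v.
Proof. by rewrite /component kill_lin scalerDr !scalerA mulrC. Qed.

Lemma weight_lagrange v :
  \sum_(l <- monsters) zval (zweight l) *: kill g (others l) v = zval 35997696%ZZ *: v.
Proof.
elim/span_ind: v => [|c u v Pu Pv|k k12].
- by rewrite !big_cons big_nil !kill0 !scaler0 !addr0.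
- rewrite scalerDr scalerA mulrC -scalerA -Pu -Pv scaler_sumr -big_split /=.
  by apply: eq_bigr => l _; rewrite kill_lin scalerDr !scalerA mulrC.
move: zlagrange => /all_iotaP/(_ _ g6)/all_iotaP/(_ _ k12)/nilP/(congr1 (veval t b)).
rewrite vevalB veval_sum big_map vevalZ veval_unit => /eqP; rewrite subr_eq0 => /eqP.
rewrite [peval _ _]/= mulr0 addr0 => <-.
by apply: eq_bigr => l _; rewrite vevalZ veval_zproj // [peval _ _]/= mulr0 addr0.
Qed.

Lemma weightE l : zval (zweight l) * zval (zdiff l (others l)) = zval 35997696%ZZ.
Proof.
rewrite -zvalM; suff -> : Z.mul (zweight l) (zdiff l (others l)) = 35997696%ZZ by [].
by case: l.
Qed.

Lemma sum_component v : v = \sum_(l <- monsters) component l v.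
Proof.
apply: (@zval_inj _ _ (iota N) _ 35997696%ZZ) => //.
rewrite -weight_lagrange scaler_sumr.
apply: eq_bigr => l _; rewrite /component scalerA -(weightE l) -mulrA.
by rewrite [zval (zdiff _ _) * _]mulrC zval_inv ?mulr1 //; exact: zdiff_others_neq0.
Qed.

Lemma zdiff_other l m : l <> m -> zdiff m (others l) = Z0.
Proof. by case: l; case: m. Qed.

Lemma component_sum (f : monster -> N) l : (forall m, eigenspace a m (f m)) ->
  component l (\sum_(m <- monsters) f m) = f l.
Proof.
move=> fE; have other m : l <> m -> component l (f m) = 0.
  by move=> /zdiff_other; exact: component_neq.
rewrite !big_cons big_nil addr0.
rewrite -[f ev1]scale1r -[f ev0]scale1r -[f ev4]scale1r !component_lin !scale1r.
by case: l other => other; rewrite (component_id (fE _)) !other // ?add0r ?addr0.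
Qed.

Lemma axis_idem : a ** a = a.
Proof.
do 2!apply: (@zval_inj _ _ (iota N) _ 192%ZZ) => //.
rewrite -{1}mZr -mZl -bg; case: Nstr => _ _ -> // _ _.
move: zmul_square => /all_iotaP/(_ _ g6)/zeqP ->.
by rewrite veval_comb big_seq1 /= bg.
Qed.

Lemma veval_single (V : lmodType (coef N)) (f : nat -> V) k u :
  (size u <= k.+1)%N -> all (fun p => nilp p) (take k u) ->
  veval t f u = peval t (nth [::] u k) *: f k.
Proof.
elim: u k f => [|p u IH] [|k] f /=; rewrite ?scale0r //.
  by case: u {IH} => // _ _; rewrite addr0.
by move=> uk /andP[/nilP -> /IH -> //]; rewrite scale0r add0r.
Qed.

Lemma axis_primitive : is_primitive a.
Proof.
move=> v; split=> [v1|[c ->]]; last first.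
  by rewrite /eigenspace mZr axis_idem /= rmorph1 scale1r.
suff [c cE] : exists c, kill g (others ev1) v = c *: a.
  by rewrite -(component_id v1) /component cE scalerA; eexists.
elim/span_ind: v {v1} => [|c u w [x ux] [y wy]|k k12].
- by exists 0; rewrite kill0 scale0r.
- by exists (c * x + y); rewrite kill_lin ux wy scalerDl scalerA.
move: zproj1_axis => /all_iotaP/(_ _ g6)/all_iotaP/(_ _ k12)/andP[sg tg].
rewrite -veval_zproj // (veval_single _ sg tg) bg scalerA.
by eexists.
Qed.

(** The shifts by S act on the component for l as the scalar [zdiff l S], a nonzero integer and
    hence a unit. *)
Lemma kill_eigensum S x l : kill g S x = 0 -> zdiff l S <> Z0 -> component l x = 0.
Proof.
move=> Sx0 lS; apply: (@zval_inj _ _ (iota N) _ (zdiff l S)) => //; rewrite scaler0.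
have killE : kill g S x = \sum_(m <- monsters) zval (zdiff m S) *: component m x.
  rewrite {1}(sum_component x) !big_cons !big_nil !addr0.
  rewrite -[component ev1 x]scale1r -[component ev0 x]scale1r -[component ev4 x]scale1r.
  by rewrite !kill_lin !scale1r !(kill_eigen _ (component_eigen _ _)).
rewrite -(component_sum (f := fun m => zval (zdiff m S) *: component m x)).
  rewrite -killE Sx0.
  by have := component_lin l (-1) 0 0; rewrite scaler0 addr0 scaleN1r addNr.
by move=> m; apply/eigenspaceZ/component_eigen.
Qed.

Lemma fusion_kill l m u v : zfusion g l m ->
  eigenspace a l u -> eigenspace a m v -> kill g (mstar l m) (u ** v) = 0.
Proof.
move=> /allP lm ul vm.
suff kk x y : kill g (mstar l m) (kill g (others l) x ** kill g (others m) y) = 0.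
  rewrite -(component_id ul) -(component_id vm) /component mZl mZr !killZ kk.
  by rewrite !scaler0.
elim/span_ind: x => [|c x x' Px Px'|k k12].
- by rewrite kill0 m0l kill0.
- by rewrite kill_lin (amul_linl Ncomm) kill_lin Px Px' scaler0 addr0.
elim/span_ind: y => [|c x x' Px Px'|k' k'12].
- by rewrite kill0 m0r kill0.
- by rewrite kill_lin (amul_linr Ncomm) kill_lin Px Px' scaler0 addr0.
rewrite -!veval_zproj // structured_mul ?lin_zproj // -veval_zkill ?lin_mulv //.
have mem n h : (h < 12)%N -> zproj g n h = [::] \/ zproj g n h \in zprojs g n.
  move=> h12; have [/nilP -> | nz] := boolP (nilp (zproj g n h)); first by left.
  by right; rewrite mem_filter nz map_f // mem_iota.
have [-> | kin] := mem l k k12; first by rewrite veval_zkill ?lin_mulv // kill0.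
have [-> | k'in] := mem m k' k'12.
  rewrite veval_zkill ?lin_mulv // -structured_mul ?lin_zproj //.
  by rewrite m0r kill0.
by have /allP/(_ _ k'in)/nilP -> := lm _ kin.
Qed.

Lemma axis_fusion l m u v : eigenspace a l u -> eigenspace a m v ->
  eigensum a (mstar l m) (u ** v).
Proof.
move: zfusion_all => /all_iotaP/(_ _ g6)/and5P[z00 z04 z44 z03 /andP[z43 z33]].
have E0 : eigenspace a ev0 0 by rewrite eigenspaceE m0r scaler0.
have sumE x : (forall n, zdiff n (mstar l m) <> Z0 -> component n x = 0) ->
    eigensum a (mstar l m) x.
  (* The four eigenvalues are distinct, so [zdiff n L] vanishes exactly when n belongs to L. *)
  move=> x0; pose f n := if zdiff n (mstar l m) is Z0 then component n x else 0.
  exists f => [n|].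
    by rewrite /f; case: zdiff => [|p|p]; first exact: component_eigen;
      rewrite eigenspaceE m0r scaler0.
  transitivity (\sum_(n <- monsters) f n).
    rewrite {1}(sum_component x); apply: eq_bigr => n _; rewrite /f.
    by case e': zdiff => [|p|p] //; apply: x0; rewrite e'.
  rewrite {}/f; case: l {x0}; case: m; rewrite !big_cons !big_nil ?addr0 ?add0r //.
have kE x : kill g (mstar l m) x = 0 -> eigensum a (mstar l m) x.
  by move=> x0; apply: sumE => n; exact: kill_eigensum x0.
(* An eigenvector for 1 is a multiple of the axis, which settles the rules involving 1. *)
have E1 n w : eigenspace a ev1 w -> forall x, eigenspace a n x ->
    eigenspace a n (w ** x).
  by move=> /axis_primitive[c ->] x xn; rewrite mZl xn; exact/eigenspaceZ/eigenspaceZ.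
move=> ul vm; apply: kE.
have kill1 n x : eigenspace a n x -> kill g [:: n] x = 0.
  by move=> xn; rewrite /= /shift (eigenspaceE n x).1 // subrr.
have ann w x : eigenspace a ev1 w -> eigenspace a ev0 x -> w ** x = 0.
  move=> /axis_primitive[c ->]; rewrite /eigenspace /= rmorph0 scale0r mZl => ->.
  exact: scaler0.
case: l ul {sumE}; case: m vm => vm ul.
- exact/kill1/E1.
- exact: ann.
- exact/kill1/E1.
- exact/kill1/E1.
- by rewrite mC; exact: ann.
- exact: fusion_kill z00 ul vm.
- exact: fusion_kill z04 ul vm.
- exact: fusion_kill z03 ul vm.
- by rewrite mC; exact/kill1/E1.
- by rewrite mC; exact: fusion_kill z04 vm ul.
- exact: fusion_kill z44 ul vm.
- exact: fusion_kill z43 ul vm.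
- by rewrite mC; exact/kill1/E1.
- by rewrite mC; exact: fusion_kill z03 vm ul.
- by rewrite mC; exact: fusion_kill z43 vm ul.
- exact: fusion_kill z33 ul vm.
Qed.

Lemma axis_is_axis : is_axis a.
Proof.
split; first exact: axis_idem.
- move=> v; exists (component^~ v) => [l|]; first exact: component_eigen.
  exact: sum_component.
- move=> f fE f0 l; rewrite -(component_sum l fE) f0.
  by have := component_lin l (-1) 0 0; rewrite scaler0 addr0 scaleN1r addNr.
- by move=> l m u v; exact: axis_fusion.
Qed.

Lemma axis_miyamoto : exists T : N -> N,
  [/\ is_miyamoto a T, forall d, T (gen N (i, d)) = gen N (i, d) &
      forall j d, j != i -> T (gen N (j, d)) = gen N (j, ~~ d)].
Proof.
(* The reflection that negates the component for 1/32 and fixes the other three. *)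
exists (fun v => v - 2%:R *: component ev32 v).
have Tb (j : 'I_3) d : 2%:R *: component ev32 (b (ax j d)) =
    if j == i then 0 else b (ax j d) - b (ax j (~~ d)).
  move: zproj_miyamoto => /all_iotaP/(_ i (ltn_ord i))/allP/(_ e).
  have eB f : f \in [:: true; false] by case: f.
  move=> /(_ (eB _))/all_iotaP/(_ j (ltn_ord j))/allP/(_ d (eB _))/nilP.
  have jd12 h : (ax j h < 12)%N by elim/ord3P: j; case: h.
  move=> /(congr1 (veval t b)); rewrite vevalB vevalZ veval_zproj // => /eqP.
  rewrite subr_eq0 /= mulr0 addr0 (zval_pos _ 2) => /eqP.
  have -> : (i : nat) == j = (j == i) by rewrite eq_sym.
  rewrite /component scalerA mulrC -scalerA => ->.
  case: eqP => _; first by rewrite /= scaler0.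
  rewrite vevalZ vevalB !veval_unit [peval _ _]/= mulr0 addr0 scalerA.
  by rewrite -[46872%ZZ]/(zdiff ev32 (others ev32)) zval_inv ?scale1r.
have Tg (j : 'I_3) d : 2%:R *: component ev32 (gen N (j, d)) =
    if j == i then 0 else gen N (j, d) - gen N (j, ~~ d).
  apply: (@zval_inj _ _ (iota N) _ 192%ZZ) => //.
  have CZ c v : component ev32 (c *: v) = c *: component ev32 v.
    by rewrite /component killZ !scalerA mulrC.
  rewrite scalerA mulrC -scalerA -CZ; case: Nstr => _ _ _ _ /[dup] gE <-.
  by rewrite Tb; case: eqP; rewrite ?scaler0 // scalerBr !gE.
split=> [|d|j d /negPf ji]; last 2 first.
- by rewrite Tg eqxx subr0.
- by rewrite Tg ji subKr.
split=> [c u v|l v vl].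
  rewrite component_lin scalerDr opprD addrACA scalerBr.
  by rewrite [2 *: (c *: _)]scalerA [c *: (2 *: _)]scalerA mulrC.
case: l vl => vl; try by rewrite (component_neq vl) // scaler0 subr0.
by rewrite (component_id vl) scaler_nat mulr2n opprD addrA subrr add0r.
Qed.

Lemma axis_norm : <[a, a]> = 1.
Proof.
have := zform_square; case: Nstr => _ _ _ fT gE /all_iotaP/(_ _ g6)/zeqP sq.
have := fT g g g12 g12; rewrite sq veval_comb big_seq1 gE (aformZl Nform).
rewrite (aformZr Nform) mulrA [_ *: 1]mulr1 -zvalM.
move=> /(congr1 ( *%R (iota N ((int_of_Z 36864%ZZ)%:~R)^-1))).
by rewrite mulrA !zval_inv // mul1r.
Qed.

End Axis.
End Structured.

Lemma veval_bigsum (S : comNzRingType) (t : S) (V : lmodType S) (f : nat -> V) n u :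
  (size u <= n)%N -> veval t f u = \sum_(k < n) peval t (nth [::] u k) *: f k.
Proof.
elim: u n f => [|p u IH] n f /= un.
  by rewrite big1 // => k _; rewrite nth_nil scale0r.
case: n un => // n un; rewrite big_ord_recl /= (IH n) //.
Qed.

(** * Subalgebras of type 4A and membership in the class *)

Section Structured.
Variables (R : realType) (N : markedAlg R) (t : coef N) (b : nat -> N).

Local Notation "u ** v" := (@amul R N u v) (at level 40, left associativity).
Local Notation "<[ u , v ]>" := (@aform R N u v).
Local Notation zval := (@zval (coef N)).
Local Notation a := (fun i e => gen N (i, e)).

Hypothesis Nstr : structured t b.

Let Ncomm : is_comm_algebra N. Proof. by case: Nstr. Qed.
Let Nform : is_frobenius_form N. Proof. by case: Nstr. Qed.
Let mZr := amulZr Ncomm.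
Let mZl := amulZl Ncomm.

Lemma structured_gen (i : 'I_3) e : b (ax i e) = zval 192%ZZ *: gen N (i, e).
Proof. by case: Nstr. Qed.

Lemma structured_entry i j : (i < 12)%N -> (j < 12)%N ->
  b i ** b j = veval t b (entry mul_table i j).
Proof. by case: Nstr => _ _ + _ _; apply. Qed.

Lemma boolE e : e \in [:: true; false]. Proof. by case: e. Qed.

Lemma zmul_knownE (i j : 'I_3) e d : i != j ->
  [/\ entry mul_table (ax i e) (ax j d) = axis_axis i e j d,
      entry mul_table (ax i e) (vx i j) = axis_idem4A i e j
    & entry mul_table (vx i j) (vx i j) = zvcomb [:: (192%ZZ, vx i j)]].
Proof.
move=> /(all_pairsP zmul_known)/allP/(_ e (boolE e)).
by case/and3P => /allP/(_ d (boolE d))/zeqP -> /zeqP -> /zeqP ->.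
Qed.

Lemma zform_knownE (i j : 'I_3) e d : i != j ->
  [/\ entry form_table (ax i e) (ax j d) = sc 1152%ZZ,
      entry form_table (ax i e) (vx i j) = sc 13824%ZZ,
      entry form_table (vx i j) (vx i j) = sc 73728%ZZ &
      entry form_table (ax i e) (ax i (~~ e)) = [::]].
Proof.
move=> /(all_pairsP zform_known)/allP/(_ e (boolE e)).
by case/and4P => /allP/(_ d (boolE d))/zeqP -> /zeqP -> /zeqP -> /zeqP ->.
Qed.

Lemma inv_scaleE (p : positive) (x y : N) :
  zval (Zpos p) *: x = y -> x = iota N (Pos.to_nat p)%:R^-1 *: y.
Proof. by move=> <-; rewrite scalerA inv_zval scale1r. Qed.

Lemma vx_scaled (i j : 'I_3) : exists v, b (vx i j) = zval 192%ZZ *: v.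
Proof.
exists (iota N ((int_of_Z 192%ZZ)%:~R)^-1 *: b (vx i j)).
by rewrite scalerA mulrC zval_inv // scale1r.
Qed.

Lemma z192_mul (x y : N) c :
  (zval 192%ZZ *: x) ** (zval 192%ZZ *: y) = c -> zval 36864%ZZ *: (x ** y) = c.
Proof. by move=> <-; rewrite mZl mZr scalerA -zvalM. Qed.

Lemma product_axes (i j : 'I_3) e d v : i != j -> b (vx i j) = zval 192%ZZ *: v ->
  a i e ** a j d = iota N 64^-1 *:
    (3 *: a i e + 3 *: a j d + a i (~~ e) + a j (~~ d) - 3 *: v).
Proof.
move=> ij bv; apply: (inv_scaleE (p := 64)).
have e1 := z192_mul (erefl ((zval 192%ZZ *: a i e) ** (zval 192%ZZ *: a j d))).
rewrite -!structured_gen structured_entry ?ax_lt12 // in e1.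
have [eq1 _ _] := zmul_knownE e d ij.
rewrite {}eq1 veval_comb !big_cons big_nil /= !structured_gen bv addr0 in e1.
apply: (@zval_inj _ _ (iota N) _ 36864%ZZ) => //.
rewrite scalerA mulrC -scalerA {}e1.
rewrite -scaleNr -(zval_pos _ 3) -zvalN.
by rewrite !scalerDr !scalerA -!zvalM -!addrA.
Qed.

Lemma sbasis_vxE (i j : 'I_3) : i != j -> b (vx i j) = zval 192%ZZ *: vax N i j.
Proof.
move=> ij; have [v bv] := vx_scaled i j.
by rewrite (vax_product (product_axes true true ij bv)).
Qed.

Lemma product_axis_vax (i j : 'I_3) e : i != j ->
  a i e ** vax N i j = iota N 16^-1 *:
    (5 *: a i e - a i (~~ e) - 2 *: a j true - 2 *: a j false + 3 *: vax N i j).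
Proof.
move=> ij; apply: (inv_scaleE (p := 16)); have bv := sbasis_vxE ij.
have e1 := z192_mul (erefl ((zval 192%ZZ *: a i e) ** (zval 192%ZZ *: vax N i j))).
rewrite -bv -structured_gen structured_entry ?ax_lt12 ?vx_lt12 // in e1.
have [_ eq1 _] := zmul_knownE e true ij; set v := vax N i j in bv e1 *.
rewrite {}eq1 veval_comb !big_cons big_nil /= !structured_gen bv addr0 in e1.
apply: (@zval_inj _ _ (iota N) _ 36864%ZZ) => //.
rewrite scalerA mulrC -scalerA {}e1.
rewrite -(zval_pos _ 5) -(zval_pos _ 2) -!scaleNr -(zval_pos _ 3).
rewrite -[- a i _]scaleN1r -(zval1 (coef N)) -!zvalN.
by rewrite !scalerDr !scalerA -!zvalM -!addrA.
Qed.

Lemma vax_idem (i j : 'I_3) : i != j -> vax N i j ** vax N i j = vax N i j.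
Proof.
move=> ij; have bv := sbasis_vxE ij.
have e1 := z192_mul (erefl ((zval 192%ZZ *: vax N i j) ** (zval 192%ZZ *: vax N i j))).
rewrite -bv structured_entry ?vx_lt12 // in e1.
have [_ _ eq1] := zmul_knownE true true ij.
rewrite {}eq1 veval_comb big_seq1 /= bv scalerA -zvalM in e1.
exact: (@zval_inj _ _ (iota N) _ 36864%ZZ).
Qed.

Lemma product_opposite (i : 'I_3) : a i true ** a i false = 0.
Proof.
apply: (@zval_inj _ _ (iota N) _ 36864%ZZ) => //; rewrite scaler0; apply: z192_mul.
rewrite -!structured_gen structured_entry ?ax_lt12 //.
by move: zmul_axis => /all_iotaP/(_ i (ltn_ord i))/andP[/zeqP -> _].
Qed.

Lemma form_scaled k l (x y : N) c : (k < 12)%N -> (l < 12)%N ->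
  b k = zval 192%ZZ *: x -> b l = zval 192%ZZ *: y ->
  entry form_table k l = sc c -> zval 36864%ZZ * <[x, y]> = zval c.
Proof.
move=> k12 l12 bk bl e.
case: Nstr => _ _ _ /(_ _ _ k12 l12) + _; rewrite bk bl e.
rewrite (aformZl Nform) (aformZr Nform) mulrA -zvalM => ->.
by rewrite veval_comb big_seq1 [_ *: _]mulr1.
Qed.

Lemma zval_injs c (x y : coef N) : c <> Z0 -> zval c * x = zval c * y -> x = y.
Proof. exact: (zval_inj (iota N) (V := (coef N)^o)). Qed.

Lemma form_axes (i j : 'I_3) e d : i != j -> <[a i e, a j d]> = iota N 32^-1.
Proof.
move=> ij; have [eq1 _ _ _] := zform_knownE e d ij.
apply: (@zval_injs 36864%ZZ) => //.
rewrite (form_scaled _ _ (structured_gen i e) (structured_gen j d) eq1) ?ax_lt12 //.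
rewrite (zvalM _ 1152%ZZ 32%ZZ : zval 36864%ZZ = _) -mulrA [_ * iota _ _]mulrC.
by rewrite (inv_zval N 32) mulr1.
Qed.

Lemma form_axis_vax (i j : 'I_3) e : i != j -> <[a i e, vax N i j]> = iota N (3 / 8).
Proof.
move=> ij; have [_ eq1 _ _] := zform_knownE e true ij.
apply: (@zval_injs 36864%ZZ) => //.
rewrite (form_scaled _ _ (structured_gen i e) (sbasis_vxE ij) eq1) ?ax_lt12 ?vx_lt12 //.
rewrite rmorphM (rmorph_nat (iota N) 3) -(zval_pos _ 3) mulrA -zvalM.
rewrite [zval (Z.mul _ _)](zvalM _ 13824%ZZ 8%ZZ) -mulrA [zval 8%ZZ * _]mulrC.
by rewrite (inv_zval N 8) mulr1.
Qed.

Lemma form_vax (i j : 'I_3) : i != j -> <[vax N i j, vax N i j]> = 2.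
Proof.
move=> ij; have [_ _ eq1 _] := zform_knownE true true ij.
apply: (@zval_injs 36864%ZZ) => //.
rewrite (form_scaled _ _ (sbasis_vxE ij) (sbasis_vxE ij) eq1) ?vx_lt12 //.
by rewrite -(zval_pos _ 2) -zvalM.
Qed.

Lemma form_opposite (i j : 'I_3) : i != j -> <[a i true, a i false]> = 0.
Proof.
move=> ij; have [_ _ _ eq1] := zform_knownE true true ij.
apply: (@zval_injs 36864%ZZ) => //.
rewrite mulr0 -zval0; apply: (form_scaled (c := Z0) _ _ _ _ eq1);
  by rewrite ?ax_lt12 //; exact: structured_gen.
Qed.

Definition in_span (K : seq nat) (x : N) : Prop :=
  exists c : nat -> coef N, x = \sum_(p < size K) c p *: b (nth 0%N K p).

Lemma in_span_lin K c x y :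
  in_span K x -> in_span K y -> in_span K (c *: x + y).
Proof.
move=> [f ->] [f' ->]; exists (fun p => c * f p + f' p).
rewrite scaler_sumr -big_split /=; apply: eq_bigr => p _.
by rewrite scalerDl scalerA.
Qed.

Lemma in_span0 K : in_span K 0.
Proof. by exists (fun=> 0); rewrite big1 // => p _; rewrite scale0r. Qed.

Lemma in_span_basis K k : k \in K -> in_span K (b k).
Proof.
move=> kK; exists (fun p => if p == index k K then 1 else 0).
rewrite (bigD1 (Ordinal (etrans (index_mem k K) kK))) //= eqxx scale1r nth_index //.
rewrite big1 ?addr0 // => p /negP np; case: eqP => [pk|]; rewrite ?scale0r //.
by case: np; apply/eqP/val_inj.
Qed.

Lemma in_span_ind K (P : N -> Prop) : P 0 ->
  (forall c x y, P x -> P y -> P (c *: x + y)) -> (forall k, k \in K -> P (b k)) ->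
  forall x, in_span K x -> P x.
Proof.
move=> P0 PD Pb x [c ->]; elim/big_ind: _ => // [u v Pu Pv|p _].
  by rewrite -[u]scale1r; apply: PD.
by rewrite -[_ *: _]addr0; apply: PD => //; apply/Pb/mem_nth.
Qed.

Lemma in_span_veval K u : (size u <= 12)%N -> supported K u -> in_span K (veval t b u).
Proof.
move=> u12 /all_iotaP Ku; rewrite (veval_bigsum _ _ u12).
elim/big_ind: _ => [|x y Kx Ky|k _]; first exact: in_span0.
  by rewrite -[x]scale1r; apply: in_span_lin.
have /orP[kK|/nilP ->] := Ku k (ltn_ord k).
  rewrite -[_ *: _]addr0; apply: in_span_lin; last exact: in_span0.
  exact: in_span_basis.
by rewrite scale0r; exact: in_span0.
Qed.

Lemma span4A_mul (i j : 'I_3) x y : i != j ->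
  in_span (span4A i j) x -> in_span (span4A i j) y -> in_span (span4A i j) (x ** y).
Proof.
move=> ij Kx Ky.
have K12 k : k \in span4A i j -> (k < 12)%N.
  by rewrite !inE => /or4P[|||/orP[]] /eqP ->; rewrite ?ax_lt12 ?vx_lt12.
elim/in_span_ind: Kx => [|c u v Pu Pv|k kK].
- by rewrite (amul0l Ncomm); exact: in_span0.
- by rewrite (amul_linl Ncomm); exact: in_span_lin.
elim/in_span_ind: Ky => [|c u v Pu Pv|l lK].
- by rewrite (amul0r Ncomm); exact: in_span0.
- by rewrite (amul_linr Ncomm); exact: in_span_lin.
rewrite structured_entry ?K12 //; apply: in_span_veval; first exact: lin_entry.
by have /allP/(_ k kK)/allP/(_ l lK) := all_pairsP zspan4A ij.
Qed.

Section Subalgebra.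
Variable U : N -> Prop.
Hypothesis Usub : is_subalgebra U.
Let U0 : U 0. Proof. by case: Usub. Qed.

Let UD c u v : U u -> U v -> U (c *: u + v). Proof. by case: Usub => _ + _; apply. Qed.
Let UM u v : U u -> U v -> U (u ** v). Proof. by case: Usub => _ _; apply. Qed.
Let UZ c u : U u -> U (c *: u).
Proof. by move=> Uu; rewrite -[_ *: _]addr0; apply: UD. Qed.
Let UA u v : U u -> U v -> U (u + v).
Proof. by move=> Uu Uv; rewrite -[u]scale1r; apply: UD. Qed.

Lemma subalgebra_inv c u : c <> Z0 -> U (zval c *: u) -> U u.
Proof.
move=> c0 /(UZ (iota N ((int_of_Z c)%:~R)^-1)).
by rewrite scalerA zval_inv // scale1r.
Qed.

(** [type4A] has only a_i and a_j as generators, so the opposite axes must be produced from them;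
    [generated4A] contains a_-j with the invertible coefficient 126. *)
Lemma subalgebra_neg (i j : 'I_3) : i != j ->
  U (b (ax i true)) -> U (b (ax j true)) -> U (b (ax j false)).
Proof.
move=> ij Ui Uj; apply: (@subalgebra_inv 126%ZZ) => //.
set X := b _ in Ui; set Y := b (ax j true) in Uj.
have /zeqP/(congr1 (veval t b)) := all_pairsP zgenerated4A ij.
rewrite vevalB vevalZ -structured_mul ?lin_entry ?lin_unit ?ax_lt12 //.
rewrite veval_unit -structured_entry ?ax_lt12 // veval_comb !big_cons big_nil addr0 /=.
rewrite -/X -/Y => e.
rewrite -[_ *: b _](addKr (zval 864%ZZ *: X + zval (-126)%ZZ *: Y)).
rewrite -addrA -e; apply: UA.
  by rewrite -scaleN1r; apply: UZ; apply: UA; exact: UZ.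
have UXY := UM Ui Uj; apply: UA; first exact: UM.
by rewrite -scaleN1r; do 2!apply: UZ.
Qed.

Lemma subalgebra_vx (i j : 'I_3) : i != j ->
  (forall e, U (b (ax i e))) -> (forall e, U (b (ax j e))) -> U (b (vx i j)).
Proof.
move=> ij Ui Uj; apply: (@subalgebra_inv (-9)%ZZ) => //.
have := UM (Ui true) (Uj true); rewrite structured_entry ?ax_lt12 //.
have [-> _ _] := zmul_knownE true true ij.
rewrite veval_comb !big_cons big_nil addr0 /= => Up.
have drop c x y : U x -> U (c *: x + y) -> U y.
  move=> Ux Uxy; rewrite -[y](addKr (c *: x)); apply: UA => //.
  by rewrite -scaleNr; exact: UZ.
by move: Up => /(drop _ _ _ (Ui _))/(drop _ _ _ (Uj _))/(drop _ _ _ (Ui _))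
  /(drop _ _ _ (Uj _)).
Qed.

Lemma subalgebra_basis : (forall g, U (gen N g)) -> forall k, (k < 12)%N -> U (b k).
Proof.
move=> Ug.
have Ua (i : 'I_3) e : U (b (ax i e)) by rewrite structured_gen; apply: UZ.
have Uv (m : 'I_3) : U (b (vopp m)).
  by have [i [j [ij ->]]] := vopp_pair m; apply: subalgebra_vx.
move=> k k12; case: (basis_indexP k12) => [i e|m|i] //.
apply: (@subalgebra_inv 192%ZZ) => //.
have := UM (Ua i true) (Uv i); rewrite structured_entry ?ax_lt12 ?vopp_lt12 //.
move: zmul_axis => /all_iotaP/(_ i (ltn_ord i))/andP[_ /zeqP ->].
by rewrite veval_comb big_seq1.
Qed.

End Subalgebra.

Lemma span4AP (i j : 'I_3) x : i != j -> in_span (span4A i j) x <->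
  exists c1 c2 c3 c4 c5 : coef N,
    x = c1 *: a i true + c2 *: a i false + c3 *: a j true + c4 *: a j false
        + c5 *: vax N i j.
Proof.
move=> ij; have [k kz] : exists k, k * zval 192%ZZ = 1.
  by eexists; apply: (zval_inv (iota N)).
split=> [[c ->]|[c1 [c2 [c3 [c4 [c5 ->]]]]]].
  do 5!eexists; rewrite !big_ord_recl big_ord0 /= addr0 !addrA.
  by rewrite !structured_gen sbasis_vxE // !scalerA.
exists (fun p => nth 0 [:: c1; c2; c3; c4; c5] p * k).
rewrite !big_ord_recl big_ord0 /= addr0 !addrA !structured_gen sbasis_vxE //.
by rewrite !scalerA -!mulrA kz !mulr1.
Qed.

Lemma structured_type4A (i j : 'I_3) : i != j -> type4A i j (vax N i j).
Proof.
move=> ij; have ji : j != i by rewrite eq_sym.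
have vC : vax N j i = vax N i j by exact: vaxC.
split; first exact: vax_idem.
- move=> x; rewrite -span4AP //; split=> [xG|Kx U Usub UG].
    apply: xG => [|_ [->|->]].
    + split; first exact: in_span0.
        by move=> c u v; exact: in_span_lin.
      by move=> u v; exact: span4A_mul.
    + apply/span4AP => //; exists 1, 0, 0, 0, 0.
      by rewrite scale1r !scale0r !addr0.
    + apply/span4AP => //; exists 0, 0, 1, 0, 0.
      by rewrite scale1r !scale0r !addr0 !add0r.
  have UZ c u : U u -> U (c *: u).
    by case: Usub => U0 UD _ Uu; rewrite -[_ *: _]addr0; apply: UD.
  have Ui : U (b (ax i true)) by rewrite structured_gen; apply/UZ/UG; left.
  have Uj : U (b (ax j true)) by rewrite structured_gen; apply/UZ/UG; right.
  have Ui' : U (b (ax i false)) by apply: subalgebra_neg Usub _ _ ji Uj Ui.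
  have Uj' : U (b (ax j false)) by apply: subalgebra_neg Usub _ _ ij Ui Uj.
  elim/in_span_ind: Kx => [|c u v Pu Pv|k].
  + by case: Usub.
  + by case: Usub => _ UD _; apply: UD.
  rewrite !inE => /or4P[|||/orP[]] /eqP -> //.
  by apply: subalgebra_vx => // -[].
- split=> [e d|e|d||].
  + exact: product_axes (sbasis_vxE ij).
  + exact: product_axis_vax.
  + by rewrite -vC; exact: product_axis_vax.
  + exact: product_opposite.
  + exact: product_opposite.
- split=> [e d||]; first exact: form_axes.
    exact: form_opposite ij.
  exact: form_opposite ji.
- split=> [e|d|]; [exact: form_axis_vax | | exact: form_vax].
  by rewrite -vC; exact: form_axis_vax.
Qed.

Lemma structured_class :
  (forall v, exists c : nat -> coef N, v = \sum_(k < 12) c k *: b k) ->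
  [/\ is_primitive_frobenius_axial N, property_P N & shape4A N].
Proof.
move=> Nspan; split.
- split=> // [[i e]|v U Usub Ug].
    split; [exact: axis_is_axis Nstr Nspan _ _ | exact: axis_primitive Nstr Nspan _ _|].
    exact: axis_norm Nstr _ _.
  elim/(span_ind Nspan): v => [|c u v Uu Uv|k k12].
  + by case: Usub.
  + by case: Usub => _ UD _; apply: UD.
  by apply: subalgebra_basis => // g; apply: Ug; exists g.
- by move=> i e; exact: axis_miyamoto Nstr i e.
- exists (vax N); split=> [i j|i j ij]; first exact: vaxC.
  exact: structured_type4A.
Qed.

End Structured.

Lemma member_structured (R : realType) (N : markedAlg R) :
  [/\ is_primitive_frobenius_axial N, property_P N & shape4A N] ->
  structured (tpar N) (@sbasis R N).
Proof.
move=> Nclass; have [M_ok F_ok] := final_ok Nclass.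
split; [exact: Ncomm Nclass | exact: Nform Nclass | | | by move=> i e; exact: sbasis_ax].
  by move=> i j i12 j12; rewrite M_ok // veval_small //; exact: lin_entry.
(* The final form table has entries of size at most 1: only the constant coordinate occurs, and no
   unknown value is left. *)
move=> i j i12 j12; rewrite F_ok //; apply: eq_veval => -[//|k].
suff -> : (k.+1 < size (entry form_table i j))%N = false by [].
apply/negbTE; rewrite -leqNgt; apply: (@leq_trans 1) => //.
rewrite /entry; have [ij|ij] := ltnP (12 * i + j) (size form_table).
  exact: (all_nthP [::] (proj2 tables_lin)).
by rewrite nth_default.
Qed.

Section Structured.
Variables (R : realType) (N : markedAlg R) (t : coef N) (b : nat -> N).
Hypothesis Nstr : structured t b.

(** The axes fix the remaining elements: the table gives v_(i,j) from a_i a_j and then x_i from a_i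
    v_(j,k). *)
Lemma structured_sbasis k : (k < 12)%N -> sbasis N k = b k.
Proof.
have Ncomm : is_comm_algebra N by case: Nstr.
move=> k12; case: (basis_indexP k12) => [i e|m|i].
- by rewrite sbasis_ax (structured_gen Nstr).
- have [i [j [ij ->]]] := vopp_pair m; rewrite (sbasis_vxE Nstr ij).
  move: ij; rewrite neq_ltn => /orP[|ij]; first exact: sbasis_vx.
  by rewrite /vx addnAC (vaxC i j Ncomm) -sbasis_vx.
have [j [k' [u jk]]] : exists j k : 'I_3, uniq [:: i; j; k] /\ (j < k)%N.
  by elim/ord3P: i {k12}; [exists i2, i3 | exists i1, i3 | exists i1, i2].
apply: (@zval_inj _ _ (iota N) _ 192%ZZ) => //.
have := structured_entry Nstr (ax_lt12 i true) (vopp_lt12 i).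
move: zmul_axis => /all_iotaP/(_ i (ltn_ord i))/andP[_ /zeqP ->].
rewrite veval_comb big_seq1 /= => <-.
have bv : b (vopp i) = zval (coef N) 192%ZZ *: vax N j k'.
  have -> : vopp i = vx j k'.
    by elim/ord3P: i u {k12}; elim/ord3P: j jk; elim/ord3P: k'.
  by apply: sbasis_vxE Nstr _ _ _; rewrite neq_ltn jk.
by rewrite (sbasis_xx _ u) // bv (structured_gen Nstr) (amulZl Ncomm) (amulZr Ncomm).
Qed.

Lemma structured_tpar : tpar N = t.
Proof.
apply: (@zval_injs _ N 36864%ZZ) => //.
have b8 : b 8 = zval (coef N) 192%ZZ *: vax N i2 i3.
  exact: (sbasis_vxE Nstr (i := i2) (j := i3) isT).
case: (Nstr) => _ Nform _ /(_ 0%N 8 isT isT) + gE.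
rewrite (gE i1 true : b 0%N = _) b8.
have -> : entry form_table 0 8 = [:: [:: 0; 36864]]%ZZ by vm_compute.
rewrite [veval _ _ _]/= zval0 mulr0 !addr0 add0r [_ *: 1]mulr1 [t * _]mulrC => <-.
by rewrite (aformZl Nform) (aformZr Nform) mulrA -zvalM.
Qed.

End Structured.

(** * The model over the polynomial ring *)

Section Model.
Variable R : realType.
Notation P := {poly R}.
Notation V := 'rV[P]_12.

Definition delta (k : nat) : V := delta_mx 0 (inord k).

Definition bilinear_of (W : lmodType P) (f : nat -> nat -> W) (u v : V) : W :=
  \sum_(i < 12) \sum_(j < 12) (u 0 i * v 0 j) *: f i j.

(** The unit vectors play the role of 192 times the basis, to which the tables refer; the generators
    are therefore divided by 192. *)
Definition model : markedAlg R :=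
  @MarkedAlg R P (polyC : {rmorphism R -> P}) V
    (bilinear_of (fun i j => veval 'X delta (entry mul_table i j)))
    (bilinear_of (fun i j => veval 'X (fun=> 1 : P^o) (entry form_table i j)))
    (fun g => (192%:R^-1)%:P *: delta (ax g.1 g.2)).

Lemma bilinear_ofl (W : lmodType P) (f : nat -> nat -> W) c x y z :
  bilinear_of f (c *: x + y) z = c *: bilinear_of f x z + bilinear_of f y z.
Proof.
rewrite /bilinear_of scaler_sumr -big_split; apply: eq_bigr => i _ /=.
rewrite scaler_sumr -big_split; apply: eq_bigr => j _ /=.
by rewrite !mxE mulrDl scalerDl scalerA mulrA.
Qed.

Lemma bilinear_ofr (W : lmodType P) (f : nat -> nat -> W) c x y z :
  bilinear_of f z (c *: x + y) = c *: bilinear_of f z x + bilinear_of f z y.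
Proof.
rewrite /bilinear_of scaler_sumr -big_split; apply: eq_bigr => i _ /=.
rewrite scaler_sumr -big_split; apply: eq_bigr => j _ /=.
by rewrite !mxE mulrDr scalerDl scalerA mulrCA.
Qed.

Lemma bilinear_of_delta (W : lmodType P) (f : nat -> nat -> W) i j :
  (i < 12)%N -> (j < 12)%N -> bilinear_of f (delta i) (delta j) = f i j.
Proof.
move=> i12 j12; rewrite /bilinear_of (bigD1 (inord i)) //= (bigD1 (inord j)) //=.
rewrite !mxE !eqxx mulr1 scale1r !inordK // big1 ?addr0 => [|k /negPf kj].
  rewrite big1 ?addr0 // => k /negPf ki; rewrite big1 // => l _.
  by rewrite !mxE ki mul0r scale0r.
by rewrite !mxE kj mulr0 scale0r.
Qed.

Lemma model_span (v : V) : v = \sum_(k < 12) v 0 k *: delta k.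
Proof.
rewrite {1}[v]row_sum_delta; apply: eq_bigr => k _; congr (_ *: delta_mx 0 _).
by apply: val_inj; rewrite /= inordK.
Qed.

Lemma model_ind (Q : V -> Prop) : Q 0 ->
  (forall c u v, Q u -> Q v -> Q (c *: u + v)) ->
  (forall k, (k < 12)%N -> Q (delta k)) -> forall v, Q v.
Proof.
move=> Q0 QD Qb v; rewrite [v]model_span.
elim/big_ind: _ => // [x y Px Py|k _]; first by rewrite -[x]scale1r; apply: QD.
by rewrite -[_ *: _]addr0; apply: QD => //; exact: Qb.
Qed.

Lemma model_structured : structured (N := model) 'X delta.
Proof.
have m_ok : table_ok 'X (@amul R model) delta delta mul_table.
  by move=> i j i12 j12; exact: bilinear_of_delta.
have f_ok : table_ok 'X (@aform R model : V -> V -> P^o) delta (fun=> 1) form_table.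
  by move=> i j i12 j12; exact: (@bilinear_of_delta P^o).
have ml c x y z : @amul R model (c *: x + y) z = c *: amul x z + amul y z.
  exact: bilinear_ofl.
have mr c x y z : @amul R model z (c *: x + y) = c *: amul z x + amul z y.
  exact: bilinear_ofr.
have fl c x y z : @aform R model (c *: x + y) z = c * aform x z + aform y z.
  exact: (@bilinear_ofl P^o).
have fr c x y z : @aform R model z (c *: x + y) = c * aform z x + aform z y.
  exact: (@bilinear_ofr P^o).
split=> //.
- split=> [u v|c u v w]; last exact: ml.
  rewrite /= /bilinear_of exchange_big /=; apply: eq_bigr => i _; apply: eq_bigr => j _.
  rewrite mulrC; congr (_ *: veval _ _ _).
  by move: tables_sym => /all_iotaP/(_ j (ltn_ord j))/all_iotaP/(_ i (ltn_ord i))/zeqP.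
- split=> [c u v w|c u v w|u v w|]; [exact: fl | exact: fr | |]; last first.
    exists (delta 0), (delta 0); rewrite /= bilinear_of_delta //.
    have -> : entry form_table 0 0 = sc 36864%ZZ by vm_compute.
    rewrite veval_comb big_seq1 [_ *: _]mulr1 => z0.
    have c0 : 36864%ZZ <> Z0 by [].
    have := zval_inv (polyC : {rmorphism R -> P}) c0.
    by rewrite z0 mulr0 => /eqP; rewrite eq_sym oner_eq0.
  have m0 x : @amul R model 0 x = 0 /\ @amul R model x 0 = 0.
    split; [have := ml (-1) 0 0 x | have := mr (-1) 0 0 x];
      by rewrite scaler0 addr0 scaleN1r addNr.
  have f0 x : @aform R model 0 x = 0 /\ @aform R model x 0 = 0.
    split; [have := fl (-1) 0 0 x | have := fr (-1) 0 0 x];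
      by rewrite scaler0 addr0 mulN1r addNr.
  elim/model_ind: u => [|c x y Px Py|i i12].
  + by rewrite (m0 v).1 !(proj1 (f0 _)).
  + by rewrite [LHS]fl Px Py ml [RHS]fl.
  elim/model_ind: v => [|c x y Px Py|j j12].
  + by rewrite (m0 w).1 (proj2 (m0 _)) (proj2 (f0 _)) (proj1 (f0 _)).
  + by rewrite ml [LHS]fr Px Py mr [RHS]fl.
  elim/model_ind: w => [|c x y Px Py|k k12].
  + by rewrite (proj2 (m0 _)) !(proj2 (f0 _)).
  + by rewrite mr [LHS]fr Px Py [RHS]fr.
  rewrite !m_ok // -[X in aform X _](veval_unit 'X) -[X in _ = aform _ X](veval_unit 'X).
  have fE x y : lin x -> lin y ->
      @aform R model (veval 'X delta x) (veval 'X delta y) =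
      veval 'X (fun=> 1 : P^o) (mulv form_table x y).
    move=> lx ly; apply: (veval_mulv (B := @aform R model : V -> V -> P^o)) => //.
  rewrite !fE ?lin_unit ?lin_entry //.
  move: tables_frobenius => /all_iotaP/(_ i i12)/all_iotaP/(_ j j12)/all_iotaP/(_ k k12).
  move=> /nilP/(congr1 (veval 'X (fun=> 1 : P^o))); rewrite vevalB => /eqP.
  by rewrite subr_eq0 => /eqP.
- move=> i e; rewrite /= scalerA.
  have c0 : 192%ZZ <> Z0 by [].
  have := zval_inv (polyC : {rmorphism R -> P}) c0.
  by rewrite mulrC => ->; rewrite scale1r.
Qed.

End Model.

(** * The universal pair *)

Section SemilinearExtension.
Variables (K : choiceType) (A B : comNzRingType) (rho : {rmorphism A -> B}).
Variables (W : lmodType B) (F : K -> W).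

(** Linear extension along a change of scalars: over the identity it describes the product and the
    form of the hat algebra, over [Reval] the evaluation in the model. *)
Definition semiext (f : {malg A[K]}) : W := \sum_(x <- msupp f) rho f@_x *: F x.

Lemma semiextEw (d : {fset K}) f : (msupp f `<=` d)%fset ->
  semiext f = \sum_(x <- d) rho f@_x *: F x.
Proof.
move=> le; rewrite /semiext (big_fset_incl _ le) // => x _ /mcoeff_outdom ->.
by rewrite rmorph0 scale0r.
Qed.

Lemma semiext_lin c f g : semiext (c *: f + g) = rho c *: semiext f + semiext g.
Proof.
pose d := (msupp (c *: f + g) `|` msupp f `|` msupp g)%fset.
rewrite (@semiextEw d (c *: f + g)) ?(@semiextEw d f) ?(@semiextEw d g) /d;
  try by apply/fsubsetP => x; rewrite !inE => ->; rewrite ?orbT.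
rewrite scaler_sumr -big_split /=; apply: eq_bigr => x _.
by rewrite mcoeffD mcoeffZ rmorphD rmorphM scalerDl scalerA.
Qed.

Lemma semiextU x : semiext << x >> = F x.
Proof. by rewrite (semiextEw msuppU_le) big_seq_fset1 mcoeffUU rmorph1 scale1r. Qed.

End SemilinearExtension.

Lemma malg_ind (K : choiceType) (A : nzRingType) (P : {malg A[K]} -> Prop) :
  P 0 -> (forall c f g, P f -> P g -> P (c *: f + g)) -> (forall x, P << x >>) ->
  forall f, P f.
Proof.
move=> P0 PD PU f; rewrite [f]monalgE; elim/big_ind: _ => // [g h Pg Ph|x _].
  by rewrite -[g]scale1r; apply: PD.
suff -> : << f@_x *g x >> = f@_x *: << x >> + 0 by apply: PD.
apply/malgP => y; rewrite mcoeffD mcoeffZ mcoeff0 addr0 !mcoeffU.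
by case: eqP; rewrite ?mulr1n ?mulr1 ?mulr0n ?mulr0.
Qed.

Lemma cmonom_ind (I : choiceType) (P : {cmonom I} -> Prop) :
  P mone -> (forall i m, P m -> P (mmul (ucm i) m)) -> forall m, P m.
Proof.
move=> P1 PM m; have [n] := ubnP (mdeg m); elim: n m => // n IH m mn.
have [->//|m1] := eqVneq m mone.
have [i mi] : exists i, m i != 0%N.
  have : finsupp m != fset0.
    apply: contraNneq m1 => m0; apply/eqP/eqP/cmP => i; rewrite cm1.
    by apply/eqP; rewrite cmE_eq0 m0 inE.
  by case/fset0Pn => i; rewrite -cmE_neq0; exists i.
have mE : m = mmul (ucm i) (divcm m (ucm i)).
  apply/eqP/cmP => j; rewrite cmM divcmE cmU; case: eqP => [<-|_].
    by rewrite subnKC // lt0n.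
  by rewrite subn0.
rewrite mE; apply/PM/IH; move: mn; rewrite [in mdeg m]mE mdegM mdegU.
by rewrite ltnS.
Qed.

Section MonomialEvaluation.
Variables (I : choiceType) (S : comNzRingType) (h : I -> S).

Definition cmeval (m : {cmonom I}) : S := \prod_(i <- finsupp m) h i ^+ m i.

Lemma cmevalEw (d : {fset I}) (m : {cmonom I}) : (finsupp m `<=` d)%fset ->
  cmeval m = \prod_(i <- d) h i ^+ m i.
Proof.
move=> le; rewrite /cmeval (big_fset_incl _ le) // => i _.
by rewrite -cmE_eq0 => /eqP ->; rewrite expr0.
Qed.

Lemma cmeval_mmorphism : mmorphism cmeval.
Proof.
split=> [m n|]; last by rewrite /cmeval mdom1 big_seq_fset0.
rewrite !(@cmevalEw (finsupp m `|` finsupp n)%fset) ?mdomD ?fsubsetUl ?fsubsetUr //.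
by rewrite -big_split; apply: eq_bigr => i _; rewrite cmM exprD.
Qed.
HB.instance Definition _ := isMultiplicative.Build {cmonom I} S cmeval cmeval_mmorphism.

Lemma cmevalU i : cmeval (ucm i) = h i.
Proof. by rewrite /cmeval mdomU big_seq_fset1 cmUU expr1. Qed.

End MonomialEvaluation.

(** * The free commutative magma and the hat algebra *)

Lemma tpi_eq x y : tree_rel x y ->
  \pi_({eq_quot tree_equiv}) x = \pi_({eq_quot tree_equiv}) y.
Proof. by move=> xy; apply/eqmodP/asboolP. Qed.

Lemma repr_tpi x : tree_rel (repr (\pi_({eq_quot tree_equiv}) x)) x.
Proof. by apply/asboolP; apply/(eqmodP tree_equiv); rewrite reprK. Qed.

Lemma tpi_Node x y : \pi_({eq_quot tree_equiv}) (Node x y) =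
  tmul (\pi_({eq_quot tree_equiv}) x) (\pi_({eq_quot tree_equiv}) y).
Proof. by apply: tpi_eq; apply: tree_cong; apply: tree_sym; exact: repr_tpi. Qed.

Lemma tmulC x y : tmul x y = tmul y x.
Proof. exact/tpi_eq/tree_comm. Qed.

Lemma magma_ind (P : magma -> Prop) :
  (forall g, P (tgen g)) -> (forall x y, P x -> P y -> P (tmul x y)) ->
  forall x, P x.
Proof.
move=> Pg PM x; rewrite -[x](@reprK _ {eq_quot tree_equiv}).
elim: (repr _) => [g|y Py z Pz].
  exact: Pg.
by rewrite tpi_Node; apply: PM.
Qed.

Lemma lcls_assoc x y z : lcls (tmul x y) z = lcls x (tmul y z).
Proof. by apply/(eqmodP assoc_equiv)/asboolP; exact: assoc_gen. Qed.

(** (z, xy) ~ (zx, y) = (xz, y) ~ (x, zy) = (x, yz) ~ (xy, z). The exchange needs a product: for two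
    distinct generators the two orders give different indeterminates. *)
Lemma lcls_tmulC x y z : lcls z (tmul x y) = lcls (tmul x y) z.
Proof. by rewrite -lcls_assoc (tmulC z) lcls_assoc (tmulC z) -lcls_assoc. Qed.

Lemma semiext2_linr (K : choiceType) (A : comNzRingType) (W : lmodType A)
    (F : K -> K -> W) c f g h :
  semiext idfun (fun x => semiext idfun (F x) (c *: f + g)) h =
  c *: semiext idfun (fun x => semiext idfun (F x) f) h
  + semiext idfun (fun x => semiext idfun (F x) g) h.
Proof.
rewrite scaler_sumr -big_split; apply: eq_bigr => x _ /=.
by rewrite semiext_lin scalerDr !scalerA mulrC.
Qed.

Section HatAlgebra.
Variable R : realType.
Local Notation Rhat := (Rhat R).
Local Notation Mhat := (Mhat R).

Lemma malgUZ (A : comNzRingType) (K : choiceType) (c : A) (x : K) :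
  << c *g x >> = c *: << x >> :> {malg A[K]}.
Proof.
apply/malgP => y; rewrite mcoeffZ !mcoeffU.
by case: eqP; rewrite ?mulr1n ?mulr1 ?mulr0n ?mulr0.
Qed.

Lemma hmulE (f g : Mhat) :
  hmul f g =
  semiext idfun (fun x => semiext idfun (fun y => << tmul x y >> : Mhat) g) f.
Proof.
apply: eq_bigr => x _; rewrite scaler_sumr; apply: eq_bigr => y _.
by rewrite malgUZ scalerA.
Qed.

Lemma hformE (f g : Mhat) :
  hform f g =
  semiext (W := Rhat^o) idfun
    (fun x => semiext (W := Rhat^o) idfun (fun y => lam R x y) g) f.
Proof.
apply: eq_bigr => x _; rewrite scaler_sumr; apply: eq_bigr => y _.
by rewrite [RHS]mulrA.
Qed.

Lemma hmul_linl c (f g h : Mhat) : hmul (c *: f + g) h = c *: hmul f h + hmul g h.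
Proof. by rewrite !hmulE semiext_lin. Qed.
Lemma hmul_linr c (f g h : Mhat) : hmul h (c *: f + g) = c *: hmul h f + hmul h g.
Proof.
rewrite !hmulE; exact: (semiext2_linr (fun x y => << tmul x y >> : Mhat)).
Qed.
Lemma hmulU x y : hmul << x >> << y >> = << tmul x y >> :> Mhat.
Proof. by rewrite hmulE !semiextU. Qed.
Lemma hform_linl c (f g h : Mhat) : hform (c *: f + g) h = c * hform f h + hform g h.
Proof. by rewrite !hformE semiext_lin. Qed.
Lemma hform_linr c (f g h : Mhat) : hform h (c *: f + g) = c * hform h f + hform h g.
Proof.
rewrite !hformE; exact: (semiext2_linr (W := Rhat^o) (fun x y => lam R x y)).
Qed.
Lemma hformU x y : hform << x >> << y >> = lam R x y.
Proof. by rewrite hformE !semiextU. Qed.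

Lemma hmulBl (f g h : Mhat) : hmul (f - g) h = hmul f h - hmul g h.
Proof. by rewrite addrC -scaleN1r hmul_linl scaleN1r addrC. Qed.
Lemma hmulBr (f g h : Mhat) : hmul h (f - g) = hmul h f - hmul h g.
Proof. by rewrite addrC -scaleN1r hmul_linr scaleN1r addrC. Qed.
Lemma hformBl (f g h : Mhat) : hform (f - g) h = hform f h - hform g h.
Proof. by rewrite addrC -scaleN1r hform_linl mulN1r addrC. Qed.
Lemma hformBr (f g h : Mhat) : hform h (f - g) = hform h f - hform h g.
Proof. by rewrite addrC -scaleN1r hform_linr mulN1r addrC. Qed.

Lemma hmul0r (f : Mhat) : hmul f 0 = 0.
Proof. by have := hmulBr 0 0 f; rewrite !subrr. Qed.
Lemma hmul0l (f : Mhat) : hmul 0 f = 0.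
Proof. by have := hmulBl 0 0 f; rewrite !subrr. Qed.
Lemma hform0r (f : Mhat) : hform f 0 = 0.
Proof. by have := hformBr 0 0 f; rewrite !subrr. Qed.
Lemma hform0l (f : Mhat) : hform 0 f = 0.
Proof. by have := hformBl 0 0 f; rewrite !subrr. Qed.

Lemma hmulC (f g : Mhat) : hmul f g = hmul g f.
Proof.
elim/malg_ind: f => [|c f f' Pf Pf'|x]; first by rewrite hmul0l hmul0r.
  by rewrite hmul_linl hmul_linr Pf Pf'.
elim/malg_ind: g => [|c g g' Pg Pg'|y]; first by rewrite hmul0l hmul0r.
  by rewrite hmul_linl hmul_linr Pg Pg'.
by rewrite !hmulU tmulC.
Qed.

Lemma hform_mulC (u v w : Mhat) : hform (hmul u v) w = hform w (hmul u v).
Proof.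
elim/malg_ind: u => [|c f f' Pf Pf'|x]; first by rewrite hmul0l hform0l hform0r.
  rewrite hmul_linl [LHS]hform_linl [RHS]hform_linr.
  exact: (congr2 (fun a b => c * a + b) Pf Pf').
elim/malg_ind: v => [|c f f' Pf Pf'|y]; first by rewrite hmul0r hform0l hform0r.
  rewrite hmul_linr [LHS]hform_linl [RHS]hform_linr.
  exact: (congr2 (fun a b => c * a + b) Pf Pf').
elim/malg_ind: w => [|c f f' Pf Pf'|z]; first by rewrite hform0l hform0r.
  rewrite [LHS]hform_linr [RHS]hform_linl.
  exact: (congr2 (fun a b => c * a + b) Pf Pf').
by rewrite hmulU !hformU /lam lcls_tmulC.
Qed.

Section Pair.
Variable Q : idealPair R.
Local Notation N := (quotAlg Q).

Lemma piM_surj (u : Mquo Q) : exists m, u = piM Q m.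
Proof. by exists (repM u); rewrite repMK. Qed.

Lemma piR_surj (c : Rquo Q) : exists r, c = piR Q r.
Proof. by exists (repR c); rewrite repRK. Qed.

Lemma piM_eq0 m : (m \in pI Q) = (piM Q m == 0).
Proof. by rewrite -[0](raddf0 (piM Q)) -piM_eq subr0. Qed.

Lemma piR_eq0 r : (r \in pJ Q) = (piR Q r == 0).
Proof. by rewrite -[0](raddf0 (piR Q)) -piR_eq subr0. Qed.

Lemma piM_mul (u v : Mhat) : @amul R N (piM Q u) (piM Q v) = piM Q (hmul u v).
Proof.
apply/eqP; rewrite /= /qmul -piM_eq.
set u' := repM _; set v' := repM _.
have uI : u' - u \in pI Q by rewrite piM_eq repMK.
have vI : v' - v \in pI Q by rewrite piM_eq repMK.
have -> : hmul u' v' - hmul u v = hmul v' (u' - u) + hmul u (v' - v).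
  by rewrite !hmulBr [hmul v' _]hmulC [hmul v' u]hmulC addrA subrK.
by apply: rpredD; apply: pI_ideal.
Qed.

Lemma piM_scale r m : @GRing.scale _ (carrier N) (piR Q r) (piM Q m) = piM Q (r *: m).
Proof. exact: qscale_pi. Qed.

Lemma piM_lin r (f g : Mhat) :
  piM Q (r *: f + g) = @GRing.scale _ (carrier N) (piR Q r) (piM Q f) + piM Q g.
Proof. by rewrite raddfD piM_scale. Qed.

Lemma qform_left (u v : Mhat) : hform (repM (piM Q u)) v - hform u v \in pJ Q.
Proof. by rewrite -hformBl; apply: pI_form; rewrite piM_eq repMK. Qed.

End Pair.
End HatAlgebra.

Arguments model : simpl never.

(** * Evaluation of the hat algebra in the model, and its kernels *)

Section Universal.
Variable R : realType.
Local Notation Rhat := (Rhat R).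
Local Notation Mhat := (Mhat R).
Local Notation MT := (model R).
Local Notation P := {poly R}.

Lemma model_comm : is_comm_algebra MT. Proof. by case: (model_structured R). Qed.
Lemma model_frob : is_frobenius_form MT. Proof. by case: (model_structured R). Qed.

Fixpoint tree_eval (x : tree) : MT :=
  match x with
  | Leaf g => gen MT g
  | Node y z => amul (tree_eval y) (tree_eval z)
  end.

Lemma tree_eval_rel x y : tree_rel x y -> tree_eval x = tree_eval y.
Proof.
elim=> //= [v u w _ -> _ -> //|u v|u u' v v' _ -> _ -> //].
by case: model_comm => mC _; exact: mC.
Qed.

Definition magma_eval (x : magma) : MT := tree_eval (repr (x : {eq_quot tree_equiv})).

Lemma magma_eval_pi x : magma_eval (\pi_({eq_quot tree_equiv}) x) = tree_eval x.
Proof. exact/tree_eval_rel/repr_tpi. Qed.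

Lemma magma_evalM x y : magma_eval (tmul x y) = amul (magma_eval x) (magma_eval y).
Proof. by rewrite magma_eval_pi. Qed.

Lemma magma_evalU g : magma_eval (tgen g) = gen MT g.
Proof. by rewrite magma_eval_pi. Qed.

Definition pair_eval (p : magma * magma) : P :=
  aform (magma_eval p.1) (magma_eval p.2).

Lemma pair_eval_rel p q : assoc_rel p q -> pair_eval p = pair_eval q.
Proof.
elim=> // [u v w _ -> _ -> //|u v w].
change (aform (magma_eval (tmul u v)) (magma_eval w) =
        aform (magma_eval u) (magma_eval (tmul v w)) :> P).
by rewrite !magma_evalM; case: model_frob => _ _ -> _.
Qed.

Definition lclass_eval (c : lclass) : P := pair_eval (repr (c : {eq_quot assoc_equiv})).

Lemma lclass_evalE x y : lclass_eval (lcls x y) = aform (magma_eval x) (magma_eval y).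
Proof.
suff /pair_eval_rel : assoc_rel (repr (lcls x y : {eq_quot assoc_equiv})) (x, y) by [].
by apply/asboolP; apply/(eqmodP assoc_equiv); rewrite reprK.
Qed.

Definition Reval : {rmorphism Rhat -> P} :=
  mmap (polyC : {rmorphism R -> P}) (cmeval lclass_eval).

Lemma RevalU x y : Reval (lam R x y) = aform (magma_eval x) (magma_eval y).
Proof.
transitivity (1 * cmeval lclass_eval (ucm (lcls x y))); last first.
  by rewrite mul1r cmevalU lclass_evalE.
by rewrite [LHS]mmapU; congr (_ * _); exact: polyC1.
Qed.

Lemma RevalC c : Reval (Rhat_const R c) = c%:P.
Proof. exact: mmapC. Qed.

Definition Meval (m : Mhat) : MT := semiext Reval magma_eval m.

Lemma Meval_lin r f g : Meval (r *: f + g) = Reval r *: Meval f + Meval g.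
Proof. exact: semiext_lin. Qed.

Lemma Meval0 : Meval 0 = 0.
Proof.
by have := Meval_lin (-1) 0 0; rewrite scaler0 addr0 rmorphN1 scaleN1r addNr.
Qed.

Lemma MevalU x : Meval << x >> = magma_eval x.
Proof. exact: semiextU. Qed.

Lemma MevalM f g : Meval (hmul f g) = amul (Meval f) (Meval g).
Proof.
elim/malg_ind: f => [|c f f' Pf Pf'|x].
- by rewrite hmul0l Meval0 (amul0l model_comm).
- rewrite hmul_linl (Meval_lin c (hmul f g)) (Meval_lin c f).
  rewrite (amul_linl model_comm).
  exact: (congr2 (fun a b => Reval c *: a + b) Pf Pf').
elim/malg_ind: g => [|c g g' Pg Pg'|y].
- by rewrite hmul0r Meval0 (amul0r model_comm).
- rewrite hmul_linr (Meval_lin c (hmul << x >> g)) (Meval_lin c g).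
  rewrite (amul_linr model_comm).
  exact: (congr2 (fun a b => Reval c *: a + b) Pg Pg').
by rewrite hmulU !MevalU magma_evalM.
Qed.

Lemma Meval_form f g : Reval (hform f g) = aform (Meval f) (Meval g).
Proof.
elim/malg_ind: f => [|c f f' Pf Pf'|x].
- by rewrite hform0l rmorph0 Meval0 (aform0l model_frob).
- rewrite hform_linl rmorphD rmorphM (Meval_lin c f) (aform_linl model_frob).
  exact: (congr2 (fun a b => Reval c * a + b) Pf Pf').
elim/malg_ind: g => [|c g g' Pg Pg'|y].
- by rewrite hform0r rmorph0 Meval0 (aform0r model_frob).
- rewrite hform_linr rmorphD rmorphM (Meval_lin c g) (aform_linr model_frob).
  exact: (congr2 (fun a b => Reval c * a + b) Pg Pg').
by rewrite hformU !MevalU RevalU.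
Qed.

Definition kerM : {pred Mhat} := fun m => `[< Meval m = 0 >].
Definition kerR : {pred Rhat} := fun r => Reval r == 0.

Lemma kerMP m : reflect (Meval m = 0) (m \in kerM). Proof. exact: asboolP. Qed.

Lemma kerRP r : reflect (Reval r = 0) (r \in kerR). Proof. exact: eqP. Qed.

Lemma kerM_closed : zmod_closed kerM.
Proof.
split=> [|x y /kerMP x0 /kerMP y0]; first by apply/kerMP; exact: Meval0.
by apply/kerMP; rewrite addrC -scaleN1r Meval_lin x0 y0 scaler0 addr0.
Qed.
HB.instance Definition _ := GRing.isZmodClosed.Build Mhat kerM kerM_closed.

Lemma kerR_closed : idealr_closed kerR.
Proof.
split=> [||c x y]; rewrite !unfold_in ?rmorph0 ?rmorph1 ?oner_eq0 //.
by move=> /eqP x0 /eqP y0; rewrite rmorphD rmorphM x0 y0 mulr0 addr0.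
Qed.
HB.instance Definition _ := isIdealr.Build Rhat kerR kerR_closed.

Lemma ker_scale r m : m \in kerM -> r *: m \in kerM.
Proof.
move=> /kerMP m0; apply/kerMP.
by rewrite -[_ *: m]addr0 Meval_lin m0 Meval0 scaler0 addr0.
Qed.
Lemma ker_mul m u : u \in kerM -> hmul m u \in kerM.
Proof.
move=> /kerMP u0; apply/kerMP; rewrite MevalM u0.
exact: amul0r model_comm _.
Qed.
Lemma ker_Rscale r m : r \in kerR -> r *: m \in kerM.
Proof.
rewrite unfold_in => /eqP r0; apply/kerMP.
by rewrite -[_ *: m]addr0 Meval_lin r0 Meval0 scale0r addr0.
Qed.
Lemma ker_form u m : u \in kerM -> hform u m \in kerR.
Proof.
move=> /kerMP u0; rewrite unfold_in Meval_form u0.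
by apply/eqP; exact: aform0l model_frob _.
Qed.

Definition universal_pair : idealPair R :=
  @IdealPair R kerM kerR ker_scale ker_mul ker_Rscale ker_form.

End Universal.

(** * From the model to an algebra with the same tables *)

Section StructuredFacts.
Variables (R : realType) (N : markedAlg R).

Definition pcoef (t : coef N) : {rmorphism {poly R} -> coef N} :=
  locked (horner_eval t \o map_poly (iota N) : {rmorphism {poly R} -> coef N}).

Lemma pcoefE t p : pcoef t p = poly_to_coef t p.
Proof. by rewrite /pcoef -lock. Qed.

Lemma pcoefX t : pcoef t 'X = t.
Proof. by rewrite pcoefE /poly_to_coef map_polyX hornerX. Qed.

Lemma pcoefC t c : pcoef t c%:P = iota N c.
Proof. by rewrite pcoefE /poly_to_coef map_polyC hornerC. Qed.

Lemma pcoef_peval t p : pcoef t (peval 'X p) = peval t p.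
Proof.
elim: p => [|c p IH]; first exact: rmorph0.
rewrite [peval _ _]/= [peval t _]/= rmorphD rmorphM IH pcoefX; congr (_ + _).
by rewrite !zvalE rmorph_int.
Qed.

Lemma veval_pcoef t (V : lmodType {poly R}) (W : lmodType (coef N)) (h : V -> W) f u :
  (forall c x y, h (c *: x + y) = pcoef t c *: h x + h y) ->
  h (veval 'X f u) = veval t (fun k => h (f k)) u.
Proof.
move=> hl; elim: u f => [|p u IH] f /=.
  by have := hl (-1) 0 0; rewrite scaler0 addr0 rmorphN1 scaleN1r addNr.
by rewrite hl IH pcoef_peval.
Qed.

Lemma pcoef_veval1 t u : pcoef t (veval 'X (fun=> 1 : {poly R}^o) u) =
  veval t (fun=> 1 : (coef N)^o) u.
Proof.
have hl (c : {poly R}) (x y : {poly R}^o) :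
    pcoef t (c *: x + y) = pcoef t c *: (pcoef t x : (coef N)^o) + pcoef t y.
  by rewrite rmorphD rmorphM.
have := veval_pcoef (V := {poly R}^o) (W := (coef N)^o)
  (h := fun x : {poly R}^o => pcoef t x) (fun=> 1) u hl.
by rewrite rmorph1.
Qed.

End StructuredFacts.

Section Member.
Variables (R : realType) (N : markedAlg R) (t : coef N) (b : nat -> N).
Hypothesis Nstr : structured t b.
Local Notation MT := (model R).

Let Nc : is_comm_algebra N. Proof. by case: Nstr. Qed.
Let Nf : is_frobenius_form N. Proof. by case: Nstr. Qed.

(** The model is free, so its unit vectors can be sent to [b] over the evaluation of the variable at
    t. Equality of the tables makes this map compatible with products and forms. *)
Definition from_model (v : MT) : N :=
  \sum_(k < 12) pcoef t ((v : 'rV_12) 0 k) *: b k.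

Lemma from_model_lin c u v :
  from_model (c *: u + v) = pcoef t c *: from_model u + from_model v.
Proof.
rewrite /from_model scaler_sumr -big_split; apply: eq_bigr => k _ /=.
by rewrite !mxE rmorphD rmorphM scalerDl scalerA.
Qed.

Lemma from_model0 : from_model 0 = 0.
Proof.
have := from_model_lin (-1) 0 0.
by rewrite scaler0 addr0 rmorphN1 scaleN1r addNr.
Qed.

Lemma from_model_delta k : (k < 12)%N -> from_model (delta R k) = b k.
Proof.
move=> k12; rewrite /from_model (bigD1 (inord k)) //= mxE !eqxx rmorph1 scale1r.
rewrite inordK //.
by rewrite big1 ?addr0 // => j /negPf jk; rewrite mxE jk rmorph0 scale0r.
Qed.

Lemma from_model_veval u : lin u -> from_model (veval 'X (@delta R) u) = veval t b u.
Proof.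
move=> lu; rewrite (veval_pcoef _ _ from_model_lin); apply: eq_veval => k ku.
by rewrite from_model_delta // (leq_trans ku).
Qed.

Lemma from_model_mul u v : from_model (amul u v) = amul (from_model u) (from_model v).
Proof.
have Mc := model_comm R.
elim/model_ind: u => [|c x y Px Py|i i12].
- by rewrite (amul0l Mc) from_model0 (amul0l Nc).
- by rewrite (amul_linl Mc) !from_model_lin (amul_linl Nc) Px Py.
elim/model_ind: v => [|c x y Px Py|j j12].
- by rewrite (amul0r Mc) from_model0 (amul0r Nc).
- by rewrite (amul_linr Mc) !from_model_lin (amul_linr Nc) Px Py.
rewrite !from_model_delta // (structured_entry Nstr) //.
rewrite (structured_entry (model_structured R)) //.
by apply: from_model_veval; exact: lin_entry.
Qed.

Lemma from_model_form u v : aform (from_model u) (from_model v) = pcoef t (aform u v).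
Proof.
have Mf := model_frob R.
elim/model_ind: u => [|c x y Px Py|i i12].
- by rewrite (aform0l Mf) from_model0 (aform0l Nf) rmorph0.
- by rewrite (aform_linl Mf) from_model_lin (aform_linl Nf) rmorphD rmorphM Px Py.
elim/model_ind: v => [|c x y Px Py|j j12].
- by rewrite (aform0r Mf) from_model0 (aform0r Nf) rmorph0.
- by rewrite (aform_linr Mf) from_model_lin (aform_linr Nf) rmorphD rmorphM Px Py.
rewrite !from_model_delta //; case: Nstr => _ _ _ -> // _.
case: (model_structured R) => _ _ _ -> // _.
by rewrite pcoef_veval1.
Qed.

Lemma from_model_gen g : from_model (gen MT g) = gen N g.
Proof.
case: g => i e; apply: (@zval_inj _ _ (iota N) _ 192%ZZ) => //.
rewrite -(structured_gen Nstr) -from_model_delta ?ax_lt12 //.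
rewrite (structured_gen (model_structured R)).
have := from_model_lin (zval {poly R} 192%ZZ) (gen MT (i, e)) 0.
by rewrite !addr0 from_model0 addr0 => ->; rewrite !zvalE rmorph_int.
Qed.

End Member.

(** * Minimality of the pair of kernels *)

Section Minimality.
Variables (R : realType) (Q : idealPair R).
Hypothesis Qclass : in_class4A Q.
Local Notation N := (quotAlg Q).
Local Notation Rhat := (Rhat R).
Local Notation Mhat := (Mhat R).

Let Nstr : structured (tpar N) (@sbasis R N) := member_structured Qclass.
Local Notation theta := (from_model (tpar N) (@sbasis R N)).

Lemma theta_magma (x : magma) : theta (magma_eval R x) = piM Q << x >>.
Proof.
elim/magma_ind: x => [g|x y Px Py].
  by rewrite magma_evalU (from_model_gen Nstr).
by rewrite magma_evalM (from_model_mul Nstr) Px Py piM_mul hmulU.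
Qed.

(* Generators are idempotent modulo I, so that every magma element is congruent to a
   product, and <m n, p> = <p, m n> moves an element of I to the left argument. *)
Lemma pI_form_right (u m : Mhat) : u \in pI Q -> hform m u \in pJ Q.
Proof.
move=> uI; elim/malg_ind: m => [|c f g Pf Pg|x].
- by rewrite hform0l rpred0.
- rewrite hform_linl.
  have Pf' := idealMr (idealrI := pJ Q) c Pf.
  exact: (rpredD Pf' Pg).
have prod (y z : Mhat) : hform (hmul y z) u \in pJ Q.
  by rewrite hform_mulC; apply: pI_form.
elim/magma_ind: x => [g|x y _ _]; last by rewrite -hmulU.
have gg : hmul (hgen R g) (hgen R g) - hgen R g \in pI Q.
  rewrite piM_eq; apply/eqP; rewrite -piM_mul.
  by case: Qclass => -[_ _ /(_ g)[[gg _ _ _] _ _] _] _ _.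
have gu : hform (hmul (hgen R g) (hgen R g) - hgen R g) u \in pJ Q by exact: pI_form.
rewrite hformBl in gu.
rewrite -[hform _ _](subKr (hform (hmul (hgen R g) (hgen R g)) u)).
by apply: rpredB; [exact: prod | exact: gu].
Qed.

Lemma piR_form (u v : Mhat) : @aform R N (piM Q u) (piM Q v) = piR Q (hform u v).
Proof.
apply/eqP; rewrite -[_ == _](piR_eq Q); move: (qform_left Q u v).
have vI : repM (piM Q v) - v \in pI Q by rewrite piM_eq repMK.
have := pI_form_right (repM (piM Q u)) vI.
rewrite hformBr => h1 h2; have := rpredD h1 h2.
by rewrite addrA subrK.
Qed.

(** The hat ring is generated over R by its indeterminates, and each of them becomes a value of the
    form, which [from_model_form] transports from the model. *)
Lemma piR_Reval (r : Rhat) : piR Q r = pcoef (tpar N) (Reval R r).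
Proof.
elim/malg_ind: r => [|c f g Pf Pg|m].
- by rewrite !rmorph0.
- have -> : c *: f = Rhat_const R c * f by rewrite /Rhat_const mul_malgC.
  rewrite (rmorphD (piR Q)) (rmorphM (piR Q)) (rmorphD (Reval R)) (rmorphM (Reval R)).
  by rewrite (rmorphD (pcoef _)) (rmorphM (pcoef _)) RevalC pcoefC -Pf -Pg.
elim/cmonom_ind: m => [|i m Pm].
  have -> : << mone >> = 1 :> Rhat by [].
  by rewrite !rmorph1.
have -> : << mmul (ucm i) m >> = << ucm i >> * << m >> :> Rhat.
  by rewrite malgM_def fgmulUU mulr1.
rewrite [LHS](rmorphM (piR Q)) [X in pcoef _ X](rmorphM (Reval R)).
rewrite [RHS](rmorphM (pcoef _)).
congr (_ * _); last exact: Pm.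
rewrite -[i](@reprK _ {eq_quot assoc_equiv}); case: (repr _) => x y.
rewrite -[<< _ >>]/(lam R x y) RevalU -(from_model_form Nstr) !theta_magma.
by rewrite piR_form hformU.
Qed.

(** The projection onto any member factors through the model; hence what evaluates to zero there
    lies in the ideal. *)
Lemma theta_Meval m : piM Q m = theta (Meval m).
Proof.
elim/malg_ind: m => [|c f g Pf Pg|x].
- by rewrite raddf0 Meval0 from_model0.
- by rewrite piM_lin Meval_lin from_model_lin -piR_Reval -Pf -Pg.
- by rewrite MevalU theta_magma.
Qed.

Lemma universal_pair_min :
  {subset pI (universal_pair R) <= pI Q} /\ {subset pJ (universal_pair R) <= pJ Q}.
Proof.
split=> [m /kerMP m0|r /kerRP r0]; first by rewrite piM_eq0 theta_Meval m0 from_model0.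
by rewrite piR_eq0 piR_Reval r0 rmorph0.
Qed.

End Minimality.

(** * Surjectivity of the evaluations *)

Section Surjectivity.
Variable R : realType.
Local Notation MT := (model R).
Local Notation Rhat := (Rhat R).
Local Notation Mhat := (Mhat R).

Lemma model_class :
  [/\ is_primitive_frobenius_axial MT, property_P MT & shape4A MT].
Proof.
apply: (structured_class (model_structured R)) => v.
exists (fun k => (v : 'rV_12) 0 (inord k)); rewrite {1}[v]model_span.
by apply: eq_bigr => k _; rewrite inord_val.
Qed.

Let lifts (v : MT) : Prop := exists m : Mhat, Meval m = v.

Let lifts_gen g : lifts (gen MT g).
Proof. by exists (hgen R g); rewrite MevalU magma_evalU. Qed.
Let lifts_mul u v : lifts u -> lifts v -> lifts (amul u v).
Proof. by move=> [m <-] [n <-]; exists (hmul m n); rewrite MevalM. Qed.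
Let lifts_lin r u v : lifts u -> lifts v -> lifts (Reval R r *: u + v).
Proof. by move=> [m <-] [n <-]; exists (r *: m + n); rewrite Meval_lin. Qed.
Let lifts_const c u v : lifts u -> lifts v -> lifts (iota MT c *: u + v).
Proof. by move=> lu lv; rewrite -[iota MT c]RevalC; apply: lifts_lin. Qed.

Lemma Reval_surj (p : {poly R}) : exists r, Reval R r = p.
Proof.
have addP u v : lifts u -> lifts v -> lifts (u + v).
  by move=> lu lv; rewrite -[u]scale1r -(rmorph1 (iota MT)); apply: lifts_const.
(* The variable is the value of the form on a_1 and this element. Its scalars are real and lift as
   constants; lifting arbitrary scalars would be circular here. *)
have [m mE] : lifts (vax MT i2 i3).
  rewrite /vax -scaleNr -rmorphN [X in lifts X]addrC.
  apply: lifts_const; first exact: lifts_mul.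
  rewrite [X in lifts X]addrC; apply: lifts_const => //.
  by rewrite [X in lifts X]addrC; apply: lifts_const => //; exact: addP.
elim/poly_ind: p => [|p c [r rE]]; first by exists 0; rewrite rmorph0.
exists (r * hform (hgen R (i1, true)) m + Rhat_const R c).
rewrite (rmorphD (Reval R)) (rmorphM (Reval R)) rE RevalC Meval_form mE.
rewrite MevalU magma_evalU.
by have := structured_tpar (model_structured R); rewrite /tpar => ->.
Qed.

Lemma Meval_surj (v : MT) : exists m, Meval m = v.
Proof.
case: model_class => -[_ _ _ /(_ v lifts) gen_all] _ _.
apply: gen_all => [|_ [g ->]]; last exact: lifts_gen.
split=> [|c x y lx ly|]; [by exists 0; rewrite Meval0 | | exact: lifts_mul].
by have [r <-] := Reval_surj c; apply: lifts_lin.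
Qed.

End Surjectivity.

(** * Quotients by ideals with the same elements as the kernels *)

Section KernelPair.
Variables (R : realType) (K : idealPair R).
Hypothesis KM : pI K =i pI (universal_pair R).
Hypothesis KR : pJ K =i pJ (universal_pair R).
Local Notation N := (quotAlg K).
Local Notation MT := (model R).
Local Notation Rhat := (Rhat R).
Local Notation Mhat := (Mhat R).

Lemma piM_inj (m n : Mhat) : piM K m = piM K n <-> Meval m = Meval n.
Proof.
have MB : Meval (m - n) = Meval m - Meval n.
  by rewrite addrC -scaleN1r Meval_lin rmorphN1 scaleN1r addrC.
split=> [/eqP|mn]; last first.
  by apply/eqP; rewrite -piM_eq KM; apply/kerMP; rewrite MB mn subrr.
by rewrite -piM_eq KM => /kerMP/eqP; rewrite MB subr_eq0 => /eqP.
Qed.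

Lemma piR_inj (r s : Rhat) : piR K r = piR K s <-> Reval R r = Reval R s.
Proof.
split=> [/eqP|rs]; last first.
  by apply/eqP; rewrite -piR_eq KR; apply/kerRP; rewrite rmorphB rs subrr.
by rewrite -piR_eq KR => /kerRP/eqP; rewrite rmorphB subr_eq0 => /eqP.
Qed.

(** [piR_form] presupposes membership in the class, still to be proved here. Instead, the form of
    the model shows independence of both representatives. *)
Lemma piR_form_kernel (u v : Mhat) : @aform R N (piM K u) (piM K v) = piR K (hform u v).
Proof.
have rE w : Meval (repM (piM K w)) = Meval w by apply/piM_inj; rewrite repMK.
have /piR_inj e :
    Reval R (hform (repM (piM K u)) (repM (piM K v))) = Reval R (hform u v).
  apply: etrans (Meval_form _ _) _; apply: etrans (esym (Meval_form u v)).
  exact: (congr2 (@aform R MT) (rE u) (rE v)).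
exact: e.
Qed.

Definition lift (v : MT) : Mhat := projT1 (cid (Meval_surj v)).
Lemma liftK v : Meval (lift v) = v. Proof. exact: (projT2 (cid (Meval_surj v))). Qed.

Definition model_proj (v : MT) : N := piM K (lift v).

Lemma model_projE m : model_proj (Meval m) = piM K m.
Proof. by apply/piM_inj; rewrite liftK. Qed.

(** The image of a lift of the variable; [structured_tpar] identifies it with [tpar]. *)
Definition tquot : coef N := piR K (projT1 (cid (Reval_surj ('X : {poly R})))).

Lemma pcoef_Reval r : pcoef tquot (Reval R r) = piR K r.
Proof.
move: {2}(Reval R r) (erefl (Reval R r)) => p; elim/poly_ind: p r => [|p c IH] r rE.
  by rewrite rE rmorph0 -(rmorph0 (piR K)); apply/piR_inj; rewrite rE rmorph0.
have [s sE] := Reval_surj p; pose x := projT1 (cid (Reval_surj ('X : {poly R}))).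
have xE : Reval R x = 'X := projT2 (cid (Reval_surj ('X : {poly R}))).
have -> : piR K r = piR K (s * x + Rhat_const R c).
  by apply/piR_inj; rewrite rE (rmorphD (Reval R)) (rmorphM (Reval R)) sE xE RevalC.
rewrite rE rmorphD rmorphM pcoefX pcoefC -sE IH //.
by rewrite (rmorphD (piR K)) (rmorphM (piR K)).
Qed.

Lemma model_proj_lin c u v :
  model_proj (c *: u + v) = pcoef tquot c *: model_proj u + model_proj v.
Proof.
have [r <-] := Reval_surj c; rewrite pcoef_Reval -piM_lin.
by apply/piM_inj; rewrite Meval_lin !liftK.
Qed.

Definition quot_basis (k : nat) : N := model_proj (@delta R k).

Lemma kernel_structured : structured tquot quot_basis.
Proof.
have Mf := model_frob R; case: (model_structured R) => _ _ mT fT gE.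
split.
- split=> [u v|c u v w].
    have [m ->] := piM_surj u; have [n ->] := piM_surj v.
    by rewrite !piM_mul hmulC.
  have [m ->] := piM_surj u; have [n ->] := piM_surj v; have [k ->] := piM_surj w.
  have [r ->] := piR_surj c.
  apply: etrans (congr1 (fun x => @amul R N x (piM K k)) (esym (piM_lin K r m n))) _.
  apply: etrans (piM_mul K _ _) _; rewrite hmul_linl; apply: etrans (piM_lin K r _ _) _.
  exact: (congr2 (fun x y : N => piR K r *: x + y)
                 (esym (piM_mul K _ _)) (esym (piM_mul K _ _))).
- split=> [c u v w|c u v w|u v w|].
  + have [m ->] := piM_surj u; have [n ->] := piM_surj v; have [k ->] := piM_surj w.
    have [r ->] := piR_surj c.
    apply: etrans (congr1 (fun x => @aform R N x (piM K k)) (esym (piM_lin K r m n))) _.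
    apply: etrans (piR_form_kernel _ _) _.
    rewrite hform_linl (rmorphD (piR K)) (rmorphM (piR K)).
    exact: (congr2 (fun x y => piR K r * x + y) (esym (piR_form_kernel _ _))
                   (esym (piR_form_kernel _ _))).
  + have [m ->] := piM_surj u; have [n ->] := piM_surj v; have [k ->] := piM_surj w.
    have [r ->] := piR_surj c.
    apply: etrans (congr1 (@aform R N (piM K k)) (esym (piM_lin K r m n))) _.
    apply: etrans (piR_form_kernel _ _) _.
    rewrite hform_linr (rmorphD (piR K)) (rmorphM (piR K)).
    exact: (congr2 (fun x y => piR K r * x + y) (esym (piR_form_kernel _ _))
                   (esym (piR_form_kernel _ _))).
  + have [m ->] := piM_surj u; have [n ->] := piM_surj v; have [k ->] := piM_surj w.
    apply: etrans (congr1 (@aform R N (piM K m)) (piM_mul K n k)) _.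
    apply: etrans (esym (congr1 (fun x => @aform R N x (piM K k)) (piM_mul K m n))).
    apply: etrans (piR_form_kernel _ _) _; apply: etrans (esym (piR_form_kernel _ _)).
    apply/piR_inj; apply: etrans (Meval_form _ _) _.
    apply: etrans (esym (Meval_form _ _)).
    apply: etrans (congr1 (@aform R MT (Meval m)) (MevalM n k)) _.
    apply: etrans (esym (congr1 (fun x => @aform R MT x (Meval k)) (MevalM m n))).
    by case: Mf => _ _ fA _; exact: fA.
  case: Mf => _ _ _ [u [v uv]]; exists (model_proj u), (model_proj v).
  move/(etrans (esym (piR_form_kernel _ _)))/eqP.
  by rewrite -piR_eq0 KR => /kerRP; rewrite Meval_form !liftK.
- move=> i j i12 j12; rewrite -(veval_pcoef _ _ model_proj_lin) -mT //.
  apply: etrans (piM_mul K _ _) _; apply/piM_inj.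
  by apply: etrans (MevalM _ _) _; rewrite !liftK.
- move=> i j i12 j12; rewrite -pcoef_veval1 -fT //.
  apply: etrans (piR_form_kernel _ _) _; rewrite -pcoef_Reval; congr (pcoef _ _).
  by apply: etrans (Meval_form _ _) _; rewrite !liftK.
move=> i e; rewrite /quot_basis gE -[_ *: _]addr0 model_proj_lin.
have -> : model_proj 0 = 0.
  by rewrite -(raddf0 (piM K)); apply/piM_inj; rewrite liftK Meval0.
rewrite addr0 !zvalE rmorph_int; congr (_ *: _).
by rewrite -[RHS]model_projE MevalU magma_evalU.
Qed.

Lemma kernel_span (v : N) :
  exists c : nat -> coef N, v = \sum_(k < 12) c k *: quot_basis k.
Proof.
have [m ->] := piM_surj v.
exists (fun k => pcoef tquot ((Meval m : 'rV_12) 0 (inord k))).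
rewrite -model_projE {1}[Meval m]model_span.
have -> : \sum_(k < 12) pcoef tquot ((Meval m : 'rV_12) 0 (inord k)) *: quot_basis k =
          \sum_(k < 12) pcoef tquot ((Meval m : 'rV_12) 0 k) *: quot_basis k.
  by apply: eq_bigr => k _; rewrite inord_val.
have p0 : model_proj 0 = 0.
  by rewrite -(raddf0 (piM K)); apply/piM_inj; rewrite liftK Meval0.
elim/big_rec2: _ => // k x y _ <-.
by rewrite model_proj_lin.
Qed.

Lemma kernel_class : in_class4A K.
Proof. exact: structured_class kernel_structured kernel_span. Qed.

(** A vanishing combination comes from the model, where [model_proj] is injective and coordinates
    are unique; scalars are compared through [Reval]. *)
Lemma kernel_free (c : 'I_12 -> coef N) :
  \sum_k c k *: quot_basis k = 0 -> forall k, c k = 0.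
Proof.
have [r rE] : {r : 'I_12 -> Rhat | forall k, c k = piR K (r k)}.
  by exists (fun k => repR (c k)) => k; rewrite repRK.
move=> c0 k; rewrite rE -(rmorph0 (piR K)); apply/piR_inj; rewrite rmorph0.
have : model_proj (\sum_j Reval R (r j) *: @delta R j) = model_proj 0.
  have p0 : model_proj 0 = 0.
    by rewrite -(raddf0 (piM K)); apply/piM_inj; rewrite liftK Meval0.
  rewrite p0 -[RHS]c0; elim/big_rec2: _ => // j x y _ <-.
  by rewrite model_proj_lin rE pcoef_Reval.
move/piM_inj; rewrite !liftK => /rowP/(_ k); rewrite summxE (bigD1 k) //= !mxE.
rewrite inord_val !eqxx mulr1 big1 ?addr0 // => j /negPf jk.
by rewrite !mxE inord_val eq_sym jk andbF mulr0.
Qed.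

Lemma kernel_basis : is_basis (basis12 N).
Proof.
have [z1 z1K] : {z : coef N | z * zval (coef N) 192%ZZ = 1}.
  by exists (iota N ((int_of_Z 192%ZZ)%:~R)^-1); exact: zval_inv.
have bE (k : 'I_12) : zval (coef N) 192%ZZ *: tnth (basis12 N) k = quot_basis k.
  by rewrite (tnth_nth 0) -[LHS]/(sbasis N k) (structured_sbasis kernel_structured).
move=> v; have [c cE] := kernel_span v.
exists [ffun k : 'I_12 => c k * zval (coef N) 192%ZZ]; split.
  by rewrite cE; apply: eq_bigr => k _; rewrite ffunE -scalerA bE.
move=> d dE; apply/ffunP => k; rewrite ffunE; apply/eqP; rewrite -subr_eq0; apply/eqP.
have dE' : v = \sum_j (d j * z1) *: quot_basis j.
  by apply: etrans dE _; apply: eq_bigr => j _; rewrite -bE scalerA -mulrA z1K mulr1.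
have h : c k - d k * z1 = 0.
  apply: (kernel_free (c := fun j => c j - d j * z1)).
  transitivity (v - v); last exact: subrr.
  apply: etrans (esym (congr2 (fun x y : N => x - y) cE dE')); rewrite -sumrB.
  by apply: eq_bigr => j _; rewrite scalerBl.
by rewrite -[d k]mulr1 -z1K mulrA -mulrBl h mul0r.
Qed.

Lemma kernel_coef : bijective (poly_to_coef (tpar N)).
Proof.
rewrite (structured_tpar kernel_structured).
exists (fun c => Reval R (repR c)) => [p|c]; last first.
  by rewrite -pcoefE pcoef_Reval repRK.
have [r <-] := Reval_surj p; rewrite -pcoefE pcoef_Reval.
by apply/piR_inj; rewrite repRK.
Qed.

End KernelPair.

Theorem theorem5p1 (R : realType) :
  (exists P : idealPair R, is_universal4A P) /\
  (forall P : idealPair R, is_universal4A P ->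
     is_basis (basis12 (quotAlg P)) /\
     bijective (poly_to_coef (tpar (quotAlg P)))).
Proof.
have univ : is_universal4A (universal_pair R).
  split; first exact: kernel_class.
  by move=> Q; exact: universal_pair_min.
split=> [|P [Pclass Pmin]]; first by exists (universal_pair R).
(* Two universal pairs contain each other, so every universal pair has the same elements as the pair
   of kernels. *)
have [PM PR] := Pmin _ univ.1; have [MP RP] := univ.2 _ Pclass.
have KM : pI P =i pI (universal_pair R).
  by move=> m; apply/idP/idP; [exact: PM | exact: MP].
have KR : pJ P =i pJ (universal_pair R).
  by move=> m; apply/idP/idP; [exact: PR | exact: RP].
by split; [exact: kernel_basis KM KR | exact: kernel_coef KM KR].
Qed.
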